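(* Finding the median of a sequence of $n$ distinct elements has deterministic fragile complexity $\Theta(\log(\mathrm{Inv}))$: there is a deterministic comparison-based algorithm finding the median in which every element participates in $O(\log(\mathrm{Inv}))$ comparisons, where $\mathrm{Inv}$ is the number of inversions of the input, and for every $k$ there are inputs with $\mathrm{Inv}\le k$ on which any deterministic comparison-based median algorithm forces some element to participate in $\Omega(\log k)$ comparisons.
   Context: An inversion of a sequence $a_1,\dots,a_n$ is a pair of indices $i<j$ with $a_i>a_j$; $\mathrm{Inv}$ is the total number of inversions in the input. An element participates in a comparison if it is one of the two elements compared. The median is the element of middle rank (any fixed convention). Logarithms of a parameter $r$ are understood as $\log\max(r,2)$. *)

(* Defs.v *)
From mathcomp Require Import all_boot.
Set Implicit Arguments. Unset Strict Implicit. Unset Printing Implicit Defensive.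

(* Deterministic comparison-based algorithm on inputs of length n, as a
   (binary) decision tree: a node compares the elements at positions i and j
   (outcome "a i < a j" or not) and a leaf outputs the position of the answer. *)
Inductive dtree (n : nat) : Type :=
| Leaf of 'I_n
| Node of 'I_n & 'I_n & dtree n & dtree n.

Fixpoint run n (t : dtree n) (a : 'I_n -> nat) : 'I_n :=
  match t with
  | Leaf i => i
  | Node i j l r => if a i < a j then run l a else run r a
  end.

Fixpoint participations n (t : dtree n) (a : 'I_n -> nat) (e : 'I_n) : nat :=
  match t with
  | Leaf _ => 0
  | Node i j l r =>
      ((i == e) || (j == e)) +
      (if a i < a j then participations l a e else participations r a e)
  end.

Definition inv n (a : 'I_n -> nat) : nat :=
  #|[set p : 'I_n * 'I_n | (p.1 < p.2) && (a p.2 < a p.1)]|.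

(* Median (lower-median convention) of an input of length n.+1:
   the element of rank n./2 (0-based), i.e. with exactly n./2 smaller elements. *)
Definition is_median n (a : 'I_n.+1 -> nat) (i : 'I_n.+1) : bool :=
  #|[set j | a j < a i]| == n./2.

Definition median_alg n (t : dtree n.+1) : Prop :=
  forall a : 'I_n.+1 -> nat, injective a -> is_median a (run t a).

Definition lg (r : nat) : nat := trunc_log 2 (maxn r 2).

(* Main.v *)
(** Upper bound.  Elements at distance more than Inv are never inverted, so if Inv < B then, after
    cutting the input into blocks of length B, every block lies entirely below all blocks at
    least two further to the right.  This is checked with the extrema of the blocks in
    O(log B) comparisons per element, and once it holds the median is an element of known rank
    in the three middle blocks.  Trying B = 2^(2^i) for i = 0, 1, ... costs a geometric
    sum, and a failed check certifies Inv >= B.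

    What remains is selection among N elements with O(log N) comparisons per element, obtained
    from a comparator network of depth O(log N) that separates the lower half of its
    2^(M+1) positions from the upper half exactly.  Each half is cut into shells
    [2^l, 2^(l+1)).  Rounds of comparators along constant-degree bipartite expanders (which
    exist by counting tuples of permutations) push the elements lying on the wrong side from
    each shell to the next inner one, and a left and a right core [0, 2^h) exchange elements while h decreases
    from M to 1.  The number of misplaced elements decays geometrically outwards from the core,
    and at h = 1 the bounds are below 1.

    Lower bound.  Fixing n/2 elements below all others turns the median into a minimum.
    An adversary gives weight 1 to every candidate and lets the heavier candidate win each
    comparison, absorbing the weight of the loser; the answer collects the total weight, and
    its weight at most doubles with each of its comparisons.  Inputs of length 2^(log k / 2) have at most k
    inversions anyway. *)

From mathcomp Require Import ssreflect ssrfun ssrbool eqtype ssrnat fintype.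
From mathcomp Require Import fingroup perm all_boot zify ring.
Require Import Defs.
Set Implicit Arguments. Unset Strict Implicit. Unset Printing Implicit Defensive.

(** * Expanders *)

Definition perms_into (T : finType) (S A : {set T}) : {set {perm T}} :=
  [set p : {perm T} | [forall x in S, p x \in A]].

(** Precomposition with the transposition of [x] and [y] carries the first set injectively into the
    second. *)
Lemma leq_card_perms_into (T : finType) (S A : {set T}) x y :
  x \notin S -> y \notin S ->
  #|perms_into (y |: S) A| <= #|perms_into (x |: S) A|.
Proof.
move=> xS yS.
rewrite -(card_imset (mem (perms_into (y |: S) A)) (mulgI (tperm x y))).
apply/subset_leq_card/subsetP => q /imsetP[p]; rewrite !inE => /forall_inP H ->.
apply/forall_inP => z; rewrite !inE permM => /predU1P[->|zS].
  by rewrite tpermL; apply: H; rewrite !inE eqxx.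
rewrite tpermD; first by apply: H; rewrite !inE zS orbT.
- by apply: contraNneq xS => ->.
- by apply: contraNneq yS => ->.
Qed.

(** Double counting of the pairs of a [p] in [perms_into S A] and a [y] outside [S] with
    [p y \in A]: each [p] has [#|A| - #|S|] such [y], and by symmetry every [y] has as many [p] as
    [x]. *)
Lemma card_perms_into_step (T : finType) (S A : {set T}) x : x \notin S ->
  (#|T| - #|S|) * #|perms_into (x |: S) A| = (#|A| - #|S|) * #|perms_into S A|.
Proof.
move=> xS.
have -> : (#|T| - #|S|) * #|perms_into (x |: S) A|
    = \sum_(y in ~: S) #|perms_into (y |: S) A|.
  have -> : #|T| - #|S| = #|~: S| by rewrite [RHS]cardsCs setCK.
  rewrite -sum_nat_const.
  apply: eq_bigr => y; rewrite inE => yS.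
  by apply/eqP; rewrite eqn_leq !leq_card_perms_into.
have cardE y : y \in ~: S ->
    #|perms_into (y |: S) A| = \sum_(p in perms_into S A) (p y \in A).
  rewrite inE => yS; rewrite -sum1_card [RHS]big_mkcond [LHS]big_mkcond.
  apply: eq_bigr => p _; rewrite !inE.
  have -> : [forall z in y |: S, p z \in A] = (p y \in A) && [forall z in S, p z \in A].
    apply/forall_inP/andP => [H|[H1 /forall_inP H2] z].
      split; first by apply: H; rewrite !inE eqxx.
      by apply/forall_inP => z zS; apply: H; rewrite !inE zS orbT.
    by rewrite !inE => /predU1P[->//|/H2].
  by case: (p y \in A); case: [forall _ in _, _].
rewrite (eq_bigr _ cardE) exchange_big /= mulnC -sum_nat_const.
apply: eq_bigr => p; rewrite inE => /forall_inP pS.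
have -> : \sum_(y in ~: S) (p y \in A : nat) = #|(p @^-1: A) :\: S|.
  rewrite -sum1_card [LHS]big_mkcond [RHS]big_mkcond; apply: eq_bigr => y _.
  by rewrite !inE; case: (y \in S); case: (p y \in A).
rewrite cardsD (setIidPr _); last by apply/subsetP => z /pS; rewrite inE.
by rewrite card_preimset //; apply: perm_inj.
Qed.

(** A random permutation sends [S] into [A] with probability at most $(|A|/|T|)^{|S|}$, because each
    factor $(|A|-i)/(|T|-i)$ is at most $|A|/|T|$. *)
Lemma card_perms_into (T : finType) (S A : {set T}) :
  #|T| ^ #|S| * #|perms_into S A| <= #|A| ^ #|S| * #|T|`!.
Proof.
have [s] := ubnP #|S|; elim: s S => // s IH S.
have [->|/set0Pn[x xS]] := eqVneq S set0 => leS.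
  by rewrite cards0 !expn0 !mul1n -cardsT -card_perm subset_leq_card //;
    apply/subsetP => p _; apply/subsetP => z; rewrite inE.
rewrite -(setD1K xS); set S' := S :\ x.
have xS' : x \notin S' by rewrite !inE eqxx.
rewrite cardsU1 xS' /= add1n !expnS.
have := IH S'; rewrite (cardsD1 x) xS in leS => /(_ leS).
have := card_perms_into_step A xS'.
have: #|S'| < #|T|.
  rewrite -cardsT (cardsD1 x [set: T]) inE /= add1n ltnS subset_leq_card //.
  by apply/subsetP => z; rewrite !inE => /andP[-> _].
have: #|A| <= #|T| by rewrite max_card.
move: #|perms_into _ _| #|perms_into _ _| #|T| #|S'| #|A| (#|T|`!) => N' N b s' t F tb sb E H.
rewrite -mulnA mulnCA -mulnA.
have HN : b * N <= t * N'.
  rewrite -(@leq_pmul2l (b - s')) ?subn_gt0 // mulnCA E !mulnA leq_mul2r; apply/orP; right.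
  by rewrite mulnBr mulnBl leq_sub2l // [b * s']mulnC leq_mul2l tb orbT.
apply: leq_trans (leq_mul (leqnn (b ^ s')) HN) _.
by rewrite mulnCA leq_mul2l H orbT.
Qed.

(** * Elementary estimates for the union bound *)

Lemma leq_expn m n e : m <= n -> m ^ e <= n ^ e.
Proof. by case: e => // e mn; rewrite leq_exp2r. Qed.

Lemma expn_leq_bin_fact n k : k <= n -> (n - k).+1 ^ k <= 'C(n, k) * k`!.
Proof.
move=> kn; rewrite bin_ffact; elim: k kn => // k IH kn.
rewrite ffactnSr expnSr leq_mul // ?subnSK //.
by apply: leq_trans (IH (ltnW kn)); apply: leq_expn; lia.
Qed.

(** A weak Stirling bound: $(s+1)^s \le \binom{2s}{s} s!$, and $\binom{2s}{s}$ is one term of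
    $(1+1)^{2s}$. *)
Lemma expn_leq_fact s : s ^ s <= 4 ^ s * s`!.
Proof.
have H : s <= s + s by rewrite leq_addr.
have := expn_leq_bin_fact H; rewrite addnK => H1.
apply: leq_trans (leq_trans H1 _); first by apply: leq_expn; lia.
rewrite leq_mul2r; apply/orP; right.
rewrite -[4]/(2 ^ 2) -expnM mul2n -addnn.
rewrite -[2]/(1 + 1) expnDn (bigD1 (inord s)) //= inordK ?ltnS //.
by rewrite !exp1n !muln1 leq_addr.
Qed.

Lemma bin_leq_expn b s : 'C(b, s) * s ^ s <= (4 * b) ^ s.
Proof.
rewrite expnMn -(@leq_pmul2r s`!) ?fact_gt0 // mulnAC bin_ffact mulnC.
apply: leq_trans (leq_mul (expn_leq_fact s) (leqnn _)) _.
rewrite mulnAC leq_mul2r; apply/orP; right; rewrite leq_mul2l; apply/orP; right.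
elim: s => // s IH; rewrite ffactnSr expnSr leq_mul //; exact: leq_subr.
Qed.

(** Bernoulli's inequality bounds $(m/(m-1))^D$ below by $1 + D/(m-1)$; for [m = 1] the left side
    vanishes. *)
Lemma expn_gap C m : 0 < m -> exists D, C * m.-1 ^ D <= m ^ D.
Proof.
case: m => // m _ /=.
have Bern n : m ^ n.+1 + n.+1 * m ^ n <= m.+1 ^ n.+1.
  elim: n => [|n IH]; first by rewrite !expn1 expn0; lia.
  rewrite expnS [in leqRHS]expnS.
  by move: IH; rewrite !expnS; nia.
exists (C * m).+1; case: m Bern => [|m] Bern; first by rewrite exp0n // muln0.
apply: leq_trans (Bern _); rewrite [in leqLHS]expnS mulnA mulSn.
by lia.
Qed.

Lemma sum_lt_geometric (N : nat -> nat) F b : 0 < F ->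
  (forall s, 0 < s -> 2 ^ s * N s <= F) -> \sum_(1 <= s < b.+1) N s < F.
Proof.
move=> F0 H.
suff: 2 ^ b * \sum_(1 <= s < b.+1) N s + F <= 2 ^ b * F.
  rewrite -(@ltn_pmul2l (2 ^ b)) ?expn_gt0 //; lia.
elim: b => [|b IH]; first by rewrite big_geq // muln0 mul1n.
rewrite big_nat_recr //= mulnDr; have := H b.+1 isT; rewrite expnS; lia.
Qed.

Lemma sum_by_card (T : finType) (G : nat -> nat) :
  \sum_(S : {set T}) G #|S| = \sum_(0 <= s < #|T|.+1) 'C(#|T|, s) * G s.
Proof.
rewrite big_mkord (partition_big (fun S : {set T} => inord #|S| : 'I_#|T|.+1) xpredT) //=.
apply: eq_bigr => i _.
rewrite -(card_draws T i) -sum_nat_const; apply: eq_big => [S|S /eqP <-].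
  by rewrite inE -val_eqE /= inordK // ltnS max_card.
by rewrite inordK // ltnS max_card.
Qed.

(** * Existence of expanders by counting tuples of permutations *)

Section Expander.

Variables (T : finType) (K m d : nat).

Definition bad_pair (SA : {set T} * {set T}) :=
  (m * #|SA.2| <= m.-1 * #|T|) && (#|SA.2| < K * #|SA.1|).

Definition expanding (p : {ffun 'I_d -> {perm T}}) :=
  [forall SA, bad_pair SA ==> ~~ [forall r, p r \in perms_into SA.1 SA.2]].

(* [N] stands for [#|perms_into S A|] and [G] for [b`!], with [s = #|S|] and [t = #|A|]; the factor
   [(4 * K) ^ s] is what the union bound over [s] and [t] consumes. *)
Lemma bad_pair_bound D b s t N G : 0 < m -> 0 < K ->
  4 ^ K.+1 * (4 * K * K) * m.-1 ^ D <= m ^ D -> d = K.+1 + D ->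
  m * t <= m.-1 * b -> t < K * s -> s <= b -> t <= b -> 0 < t ->
  b ^ s * N <= t ^ s * G ->
  N ^ d * ('C(b, s) * 'C(b, t) * (4 * K) ^ s) <= G ^ d.
Proof.
move=> m0 K0 HD ed mt tK sb tb t0 HN.
have s0 : 0 < s by case: s tK {sb HN} => //; rewrite muln0.
have b0 : 0 < b by apply: leq_trans tb.
have H1 : b ^ (s * d) * N ^ d <= t ^ (s * d) * G ^ d.
  by rewrite !expnM -!expnMn leq_expn.
have H2 := bin_leq_expn b s.
have H3 := bin_leq_expn b t.
(* The [d] factors $(t/b)^s$ are spent in three parts: one against $\binom bs$ (using [H7]), [K]
   against $\binom bt$ ([H5]), and [D] against the remaining constants ([H4]). *)
have H4 : 4 ^ (K.+1 * s) * (4 * K * K) ^ s * t ^ (D * s) <= b ^ (D * s).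
  rewrite !expnM -!expnMn leq_expn //.
  rewrite -(@leq_pmul2l (m ^ D)) ?expn_gt0 ?m0 // -[leqRHS]mulnC.
  have H := leq_expn D mt; rewrite !expnMn in H.
  rewrite mulnCA; apply: leq_trans (leq_mul (leqnn _) H) _.
  by rewrite mulnA [leqRHS]mulnC leq_mul2r HD orbT.
have H5 : t ^ (K * s) * b ^ t <= t ^ t * b ^ (K * s).
  rewrite -(subnKC (ltnW tK)) !expnD -mulnA leq_mul2l; apply/orP; right.
  by rewrite mulnC leq_mul2l leq_expn ?orbT.
have H6 : 4 ^ s * 4 ^ t <= 4 ^ (K.+1 * s).
  by rewrite -expnD leq_exp2l // mulSn leq_add2l ltnW.
have H7 : t ^ s <= K ^ s * s ^ s by rewrite -expnMn leq_expn // ltnW.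
have H8 : t ^ (s * d) * ((4 * b) ^ s * (4 * b) ^ t * (4 * K) ^ s) * K ^ s
    <= t ^ s * t ^ t * b ^ (s * d).
  have E x : x ^ (s * d) = x ^ s * x ^ (K * s) * x ^ (D * s).
    by rewrite -!expnD; congr (_ ^ _); rewrite ed; ring.
  rewrite !E !expnMn.
  have -> : t ^ s * t ^ (K * s) * t ^ (D * s) *
     (4 ^ s * b ^ s * (4 ^ t * b ^ t) * (4 ^ s * K ^ s)) * K ^ s =
     (t ^ s * b ^ s) * ((t ^ (K * s) * b ^ t) * ((4 ^ s * 4 ^ t) *
       (4 ^ s * K ^ s * K ^ s) * t ^ (D * s))) by ring.
  have -> : t ^ s * t ^ t * (b ^ s * b ^ (K * s) * b ^ (D * s)) =
     (t ^ s * b ^ s) * ((t ^ t * b ^ (K * s)) * b ^ (D * s)) by ring.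
  rewrite leq_mul2l; apply/orP; right; apply: leq_mul H5 _.
  apply: leq_trans H4; rewrite leq_mul2r; apply/orP; right.
  by rewrite -!expnMn leq_mul // expnMn.
have Z0 : 0 < s ^ s * t ^ t * b ^ (s * d) * K ^ s.
  by rewrite !muln_gt0 !expn_gt0 s0 t0 b0 K0.
rewrite -(leq_pmul2l Z0).
have -> : s ^ s * t ^ t * b ^ (s * d) * K ^ s *
    (N ^ d * ('C(b, s) * 'C(b, t) * (4 * K) ^ s)) =
  (b ^ (s * d) * N ^ d) * (('C(b, s) * s ^ s) * ('C(b, t) * t ^ t) *
    (4 * K) ^ s) * K ^ s by ring.
apply: (@leq_trans ((t ^ (s * d) * G ^ d) *
   ((4 * b) ^ s * (4 * b) ^ t * (4 * K) ^ s) * K ^ s)).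
  by do 4 apply: leq_mul => //.
have -> : (t ^ (s * d) * G ^ d) *
   ((4 * b) ^ s * (4 * b) ^ t * (4 * K) ^ s) * K ^ s =
   (t ^ (s * d) *
   ((4 * b) ^ s * (4 * b) ^ t * (4 * K) ^ s) * K ^ s) * G ^ d by ring.
rewrite leq_mul2r; apply/orP; right; apply: leq_trans H8 _.
have -> : s ^ s * t ^ t * b ^ (s * d) * K ^ s =
  (K ^ s * s ^ s) * t ^ t * b ^ (s * d) by ring.
by do 2 apply: leq_mul => //.
Qed.

(** Union bound: each non-expanding tuple is witnessed by a bad pair, and the bad pairs with
    [#|S| = s] account for at most $F/2^s$ of the [F] tuples. Bad pairs have [s > 0], so fewer than
    [F] tuples fail. *)
Lemma expanding_exists D : 0 < m -> 0 < K ->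
  4 ^ K.+1 * (4 * K * K) * m.-1 ^ D <= m ^ D -> d = K.+1 + D ->
  exists p, expanding p.
Proof.
move=> m0 K0 HD ed.
set b := #|T|; set F := (b`! ^ d).
have F0 : 0 < F by rewrite expn_gt0 fact_gt0.
pose g s t := F %/ ('C(b, s) * 'C(b, t) * (4 * K) ^ s).
have Ng (SA : {set T} * {set T}) : bad_pair SA ->
    #|perms_into SA.1 SA.2| ^ d <= g #|SA.1| #|SA.2|.
  case: SA => S A /andP[/= mA AK].
  rewrite /g leq_divRL; last by rewrite !muln_gt0 !bin_gt0 !max_card expn_gt0 muln_gt0 K0.
  have HN := card_perms_into S A; rewrite -/b in HN.
  have [A0|A0] := posnP #|A|.
    have S0 : 0 < #|S| by case: #|S| AK => //; rewrite muln0.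
    move: HN; rewrite A0 exp0n // mul0n leqn0 muln_eq0 expn_eq0.
    rewrite -leqn0 leqNgt (leq_trans S0 (max_card _)) /= => /eqP ->.
    by rewrite ed exp0n.
  exact: (@bad_pair_bound D b) mA AK (max_card _) (max_card _) A0 HN.
apply/existsP; apply: contraT; rewrite negb_exists => /forallP H.
suff : F < F by rewrite ltnn.
have cp : #|{: {perm T}}| = b`!.
  rewrite /b -cardsT -card_perm; apply: eq_card => p; rewrite !inE.
  by apply/esym/subsetP => z; rewrite inE.
have {1}-> : F = #|{: {ffun 'I_d -> {perm T}}}| by rewrite card_ffun card_ord cp.
rewrite -sum1_card.
apply: (@leq_ltn_trans (\sum_(p : {ffun 'I_d -> {perm T}})
   \sum_(SA | bad_pair SA) (p \in ffun_on (perms_into SA.1 SA.2)))).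
  apply: leq_sum => p _; have := H p; rewrite /expanding negb_forall => /existsP[SA].
  rewrite negb_imply negbK => /andP[bSA /forallP Hp].
  by rewrite (bigD1 SA) //= (_ : p \in _ = true) //; apply/ffun_onP.
rewrite exchange_big /=.
under eq_bigr => SA _ do rewrite -big_mkcond /= sum1_card card_ffun_on card_ord.
apply: leq_ltn_trans (leq_sum _ Ng) _.
pose h s t := if (m * t <= m.-1 * b) && (t < K * s) then g s t else 0.
rewrite big_mkcond -(pair_bigA _ (fun S A : {set T} => h #|S| #|A|)) /=.
under eq_bigr => S _ do rewrite (sum_by_card T (h #|S|)).
rewrite (sum_by_card T (fun s => \sum_(0 <= t < #|T|.+1) 'C(#|T|, t) * h s t)) -/b.
rewrite big_ltn // [X in _ * X]big1 ?muln0 ?add0n => [|t _]; last first.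
  by rewrite /h muln0 ltn0 andbF muln0.
apply: sum_lt_geometric => // s s0.
rewrite mulnA big_distrr /=.
have tb t : 'C(b, s) * ('C(b, t) * h s t) * (4 * K) ^ s <= (t < K * s) * F.
  rewrite /h; case: ifP => [/andP[_ ->]|]; last by rewrite !muln0.
  by rewrite mul1n mulnA mulnAC mulnC leq_trunc_div.
have cnt : \sum_(0 <= t < b.+1) (t < K * s) <= K * s.
  rewrite -big_mkcond /= sum1_count.
  apply: (@leq_trans (size (iota 0 (K * s)))); last by rewrite size_iota.
  rewrite -size_filter uniq_leq_size ?filter_uniq ?iota_uniq // => t.
  by rewrite mem_filter mem_iota add0n /= => /andP[].
have KK : K * s * 2 ^ s <= (4 * K) ^ s.
  have -> : (4 * K) ^ s = K ^ s * 2 ^ s * 2 ^ s by rewrite -!expnMn; congr (_ ^ _); ring.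
  rewrite leq_mul2r; apply/orP; right; apply: leq_mul; last exact/ltnW/ltn_expl.
  by rewrite -{1}[K]expn1 leq_pexp2l.
rewrite -(@leq_pmul2r ((4 * K) ^ s)) ?expn_gt0 ?muln_gt0 ?K0 // big_distrl /=.
apply: (@leq_trans (2 ^ s * \sum_(0 <= t < b.+1) (t < K * s) * F)).
  rewrite big_distrr /=; apply: leq_sum => t _.
  by rewrite -!mulnA leq_mul2l !mulnA -[_ * _ * h s t]mulnA tb orbT.
rewrite -big_distrl /= mulnA [leqRHS]mulnC leq_mul2r; apply/orP; right.
by apply: leq_trans KK; rewrite mulnC leq_mul2r cnt orbT.
Qed.

End Expander.

(* The hypothesis on [S] and [T] says that [T] contains the neighbourhood of [S]. *)
Definition expander (K m d b : nat) (f : nat -> nat -> nat) : Prop :=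
  [/\ forall r q, r < d -> q < b -> f r q < b,
      forall r q q', r < d -> q < b -> q' < b -> f r q = f r q' -> q = q' &
      forall S T : pred nat,
        (forall r q, r < d -> q < b -> S (f r q) -> T q) ->
        m * count T (iota 0 b) <= m.-1 * b ->
        K * count S (iota 0 b) <= count T (iota 0 b)].

Lemma count_iota_card b (P : pred nat) :
  count P (iota 0 b) = #|[set x : 'I_b | P x]|.
Proof.
rewrite -val_enum_ord count_map cardE enumT -size_filter /enum_mem; congr size.
by apply: eq_filter => x; rewrite !inE.
Qed.

Lemma expander_family K m : 0 < m -> 0 < K ->
  exists d, exists f, forall b, expander K m d b (f b).
Proof.
move=> m0 K0; have [D HD] := expn_gap (4 ^ K.+1 * (4 * K * K)) m0.
exists (K.+1 + D).
pose P b : {ffun 'I_(K.+1 + D) -> {perm 'I_b.+1}} :=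
  odflt [ffun=> 1%g] [pick p | expanding K m p].
have HP b : expanding K m (P b).
  rewrite /P; case: pickP => //= nP.
  by have [p Hp] := @expanding_exists 'I_b.+1 K m (K.+1 + D) D m0 K0 HD erefl; rewrite nP in Hp.
(* Inverses are taken because [expanding] speaks of the images of [S], whereas an edge of [expander]
   is indexed by its endpoint [q] in [T]. *)
exists (fun b r q => if b is b'.+1 then ((P b' (inord r))^-1)%g (inord q) else 0) => -[|b].
  by split=> [r q _|r q q' _|S T _ _] //=; rewrite muln0.
split=> [r q _ _|r q q' _ qb qb' /val_inj/perm_inj E|S T ST mT].
- exact: ltn_ord.
- by rewrite -(@inordK b q) // E inordK.
rewrite leqNgt; apply/negP => TK.
have /forallP/(_ ([set x : 'I_b.+1 | S x], [set x : 'I_b.+1 | T x])) := HP b.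
rewrite /bad_pair /= -!count_iota_card card_ord mT TK /= => /negP; apply.
apply/forallP => r; rewrite inE; apply/forall_inP => x; rewrite !inE => Sx.
have := ST r (P b r x) (ltn_ord r) (ltn_ord _).
by rewrite !inord_val permK => /(_ Sx).
Qed.

(** * Comparator networks and misplaced elements *)

Section Net.

Variables (P V : eqType).
Implicit Types (s : P -> V) (c : P * P) (cs : seq (P * P)) (Z : seq P).

Definition swp s x y := fun z => if z == x then s y else if z == y then s x else s z.

Definition comparator (gt : V -> V -> bool) s c :=
  if gt (s c.1) (s c.2) then swp s c.1 c.2 else s.

Definition run_net gt cs s := foldl (comparator gt) s cs.

Lemma run_net_cat gt cs1 cs2 s :
  run_net gt (cs1 ++ cs2) s = run_net gt cs2 (run_net gt cs1 s).
Proof. exact: foldl_cat. Qed.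

Lemma run_net_out gt cs s z : z \notin unzip1 cs ++ unzip2 cs ->
  run_net gt cs s z = s z.
Proof.
elim: cs s => //= c cs IH s; rewrite inE mem_cat inE !negb_or => /and4P[z1 u1 z2 u2].
rewrite IH ?mem_cat ?negb_or ?u1 // /comparator /swp.
by case: ifP => // _; rewrite (negPf z1) (negPf z2).
Qed.

Lemma perm_swp s x y Z : uniq Z -> x \in Z -> y \in Z ->
  perm_eq (map (swp s x y) Z) (map s Z).
Proof.
move=> uZ xZ yZ.
pose t z := if z == x then y else if z == y then x else z.
have tK : involutive t.
  move=> z; rewrite /t; case: (eqVneq z x) => [->|zx].
    by case: (eqVneq y x) => [->|]; rewrite ?eqxx.
  by case: (eqVneq z y) => [->|zy]; rewrite ?eqxx ?(negPf zx) ?(negPf zy).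
have -> : map (swp s x y) Z = map s (map t Z).
  rewrite -map_comp; apply: eq_map => z; rewrite /swp /t /=.
  by case: (z == x) => //; case: (z == y).
apply/perm_map/uniq_perm => //; first by rewrite map_inj_uniq //; apply: inv_inj.
have tZ z : z \in Z -> t z \in Z by rewrite /t; case: (z == x) => //; case: (z == y).
move=> z; apply/mapP/idP => [[w wZ ->]|zZ]; first exact: tZ.
by exists (t z); rewrite ?tK ?tZ.
Qed.

Lemma perm_run_net gt cs s Z : uniq Z ->
  (forall c, c \in cs -> (c.1 \in Z) = (c.2 \in Z)) ->
  perm_eq (map (run_net gt cs s) Z) (map s Z).
Proof.
move=> uZ; elim: cs s => //= c cs IH s H.
apply: perm_trans (IH _ _) _ => [c' cc'|]; first by rewrite H // inE cc' orbT.
have Hc := H c (mem_head _ _); rewrite /comparator; case: ifP => // _.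
case: (boolP (c.1 \in Z)) => c1; first by apply: perm_swp => //; rewrite -Hc.
rewrite (_ : map _ Z = map s Z) //; apply/eq_in_map => z zZ.
rewrite /swp; case: eqP => [E|_]; first by rewrite -E zZ in c1.
by case: eqP => // E; rewrite Hc -E zZ in c1.
Qed.

End Net.

Definition bgt (u v : bool) := u && ~~ v.

Lemma comparator_bgtE (P : eqType) (b : P -> bool) c z : comparator bgt b c z =
  if z == c.1 then b c.1 && b c.2 else if z == c.2 then b c.1 || b c.2 else b z.
Proof.
rewrite /comparator /bgt; case b1: (b c.1); case b2: (b c.2); rewrite /swp /=;
  by case: eqP => [E|_]; rewrite ?E ?b1 ?b2 //; case: eqP => [E|_]; rewrite ?E ?b1 ?b2.
Qed.

(** The 0-1 principle for a threshold [one]: the hypotheses say that [one] is monotone for [gt], so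
    thresholding commutes with every comparator. *)
Lemma run_net_hom (P V : eqType) (gt : V -> V -> bool) (one : V -> bool) :
  (forall u v, gt u v -> one v -> one u) ->
  (forall u v, ~~ gt u v -> one u -> one v) ->
  forall cs (s : P -> V), one \o run_net gt cs s =1 run_net bgt cs (one \o s).
Proof.
move=> gt1 gt0 cs s.
suff H b : one \o s =1 b -> one \o run_net gt cs s =1 run_net bgt cs b by exact: H.
elim: cs s b => //= c cs IH s b E; apply: IH => z.
rewrite comparator_bgtE -!E /= /comparator /swp.
case: (boolP (gt _ _)) => [/gt1|/gt0];
  case E1: (one (s c.1)); case E2: (one (s c.2)) => //= H; try by have := H isT.
all: by case: eqP => [Ez|_]; rewrite ?Ez ?E1 ?E2 //; case: eqP => [Ez|_]; rewrite ?Ez ?E1 ?E2.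
Qed.

(** * Networks acting on marked positions *)

Section Push.

Variable P : eqType.
Implicit Types (b : P -> bool) (cs : seq (P * P)).

(** A mark stands for a misplaced item. A comparator leaves [c.1] marked only if both ends were
    marked, so marks travel from [c.1] to [c.2]. *)
Definition push cs b := run_net bgt cs b.

Lemma push_incr cs b z : z \notin unzip1 cs -> b z -> push cs b z.
Proof.
elim: cs b => //= c cs IH b; rewrite inE negb_or => /andP[zc zcs] bz.
by apply: IH => //; rewrite comparator_bgtE (negPf zc); case: eqP => [<-|]; rewrite ?bz ?orbT.
Qed.

Lemma push_decr cs b z : z \notin unzip2 cs -> push cs b z -> b z.
Proof.
elim: cs b => //= c cs IH b; rewrite inE negb_or => /andP[zc zcs] /IH.
by rewrite comparator_bgtE (negPf zc) => /(_ zcs); case: eqP => // -> /andP[].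
Qed.

(* An outer position bad at the end was bad throughout, so each of its comparators made the
   inner partner bad, and inner positions stay bad. *)
Lemma push_final cs b c :
  (forall c1 c2, c1 \in cs -> c2 \in cs -> c1.1 != c2.2) ->
  c \in cs -> push cs b c.1 -> push cs b c.2.
Proof.
elim: cs b => //= c0 cs IH b H; rewrite inE => /predU1P[E|ccs]; last first.
  by apply: IH => // c1 c2 h1 h2; apply: H; rewrite inE ?h1 ?h2 orbT.
subst c0.
have n2 : c.1 \notin unzip2 cs.
  apply/mapP => -[c' c'cs E]; have := H c c' (mem_head _ _).
  by rewrite inE c'cs orbT E eqxx => /(_ isT).
have n1 : c.2 \notin unzip1 cs.
  apply/mapP => -[c' c'cs E]; have := H c' c.
  by rewrite !inE c'cs eqxx orbT E eqxx => /(_ isT isT).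
move=> /(push_decr n2); rewrite comparator_bgtE eqxx => /andP[b1 b2].
apply: push_incr => //; rewrite comparator_bgtE; case: eqP => _; first by rewrite b1 b2.
by rewrite eqxx b1.
Qed.

Lemma push_count cs b (Z : seq P) : uniq Z ->
  (forall c, c \in cs -> (c.1 \in Z) = (c.2 \in Z)) ->
  count (push cs b) Z = count b Z.
Proof.
move=> uZ H; have /permP/(_ id) := perm_run_net bgt b uZ H.
by rewrite !count_map.
Qed.

Lemma push_ext cs b1 b2 : b1 =1 b2 -> push cs b1 =1 push cs b2.
Proof.
elim: cs b1 b2 => //= c cs IH b1 b2 E; apply: IH => z.
by rewrite !comparator_bgtE !E.
Qed.

End Push.

Definition pos := (bool * nat)%type.

(* Left (false) comparators bring the larger item inwards, right ones the smaller:
   a pair is written (outer, inner) on both sides. *)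
Definition side_net (s : bool) (cs : seq (nat * nat)) : seq (pos * pos) :=
  [seq if s then ((s, c.2), (s, c.1)) else ((s, c.1), (s, c.2)) | c <- cs].

(** A left position is bad when it holds a one, a right position when it holds a zero. *)
Definition bad (s : bool) (b : pos -> bool) (p : nat) := b (s, p) (+) s.

(** On the right side badness negates the bit, which exchanges conjunction and disjunction; the
    reversed pairs in [side_net] compensate for this. *)
Lemma bad_side_net s cs b :
  bad s (push (side_net s cs) b) =1 push cs (bad s b).
Proof.
elim: cs b => //= c cs IH b z; rewrite IH {IH}.
apply: push_ext => {}z; rewrite comparator_bgtE /bad comparator_bgtE.
case: s => /=; rewrite !xpair_eqE !eqxx /= ?addbF ?addbT.
  have [E1|_] := eqVneq z c.1; have [E2|_] := eqVneq z c.2; rewrite ?addbT //.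
  - by rewrite -E1 -E2 !andbb.
  - by rewrite negb_or andbC.
  - by rewrite negb_and orbC.
by case: (z == c.1) => //; case: (z == c.2) => //; rewrite addbF.
Qed.

Lemma bad_side_netN s s' cs b : s' != s ->
  bad s' (push (side_net s cs) b) =1 bad s' b.
Proof.
move=> ss z; rewrite /bad /push run_net_out //.
apply/negP; rewrite mem_cat => /orP[] /mapP[c /mapP[c' _ ->]];
  by case: s ss => /= ss [] E _; rewrite E eqxx in ss.
Qed.

(** * The splitting network *)

Definition shell_count (b : nat -> bool) l := count b (iota (2 ^ l) (2 ^ l)).
Definition core_count (b : nat -> bool) h := count b (iota 0 (2 ^ h)).

Lemma core_countS b h : core_count b h.+1 = core_count b h + shell_count b h.
Proof. by rewrite /core_count /shell_count expnS mul2n -addnn iotaD count_cat. Qed.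

Lemma shell_count_core b l : shell_count b l <= core_count b l.+1.
Proof. by rewrite core_countS leq_addl. Qed.

Lemma core_count_leq b h : core_count b h <= 2 ^ h.
Proof. by rewrite -[leqRHS](size_iota 0) count_size. Qed.

Lemma count_iota_shift (b : pred nat) a n :
  count b (iota a n) = count (fun q => b (a + q)) (iota 0 n).
Proof. by rewrite -[in LHS](addn0 a) iotaDl count_map. Qed.

Lemma trunc_log2_shell l q : q < 2 ^ l -> trunc_log 2 (2 ^ l + q) = l.
Proof. by move=> ql; apply: trunc_log_eq => //; rewrite expnS; lia. Qed.

Lemma shellP y : 0 < y -> exists2 q, q < 2 ^ trunc_log 2 y & y = 2 ^ trunc_log 2 y + q.
Proof.
move=> y0; have /andP[H1 H2] := trunc_log_bounds (isT : 1 < 2) y0.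
by exists (y - 2 ^ trunc_log 2 y); rewrite ?subnKC //; move: H2; rewrite expnS; lia.
Qed.

Section Splitter.

Variables (d : nat) (f : nat -> nat -> nat -> nat).
Hypothesis fP : forall b, expander 256 128 d b (f b).

(** * Rounds between consecutive shells *)

Section Class.

Variable M : nat.

(* Shell [l.+1] is twice as large as shell [l]; [top] tells which half of it is matched. *)
Definition outer (top : bool) r y :=
  let b := 2 ^ trunc_log 2 y in 2 * b + top * b + f b r (y - b).

(* Restricting the inner level to one parity makes the comparators of a round disjoint. *)
Definition class_round par top r : seq (nat * nat) :=
  [seq (outer top r y, y) | y <- iota 1 (2 ^ M.-1 - 1) & odd (trunc_log 2 y) == par].

Definition class_rounds par :=
  [seq class_round par top r | top <- [:: false; true], r <- iota 0 d].

Definition class_net par := flatten (class_rounds par).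

Lemma outerE (top : bool) r l q : q < 2 ^ l ->
  outer top r (2 ^ l + q) = 2 ^ l.+1 + top * 2 ^ l + f (2 ^ l) r q.
Proof. by move=> ql; rewrite /outer trunc_log2_shell // addKn expnS. Qed.

Lemma mem_class_round par top r c : c \in class_round par top r ->
  exists l q, [/\ l.+1 < M, odd l = par, q < 2 ^ l &
    c = (2 ^ l.+1 + top * 2 ^ l + f (2 ^ l) r q, 2 ^ l + q)].
Proof.
case/mapP=> y; rewrite mem_filter mem_iota => /andP[/eqP oy /andP[y0 yM]] ->.
have [q ql yE] := shellP y0; exists (trunc_log 2 y), q; split=> //; last first.
  by rewrite -[LHS]/(outer top r y, y) {1}yE outerE // -yE.
have : 2 ^ trunc_log 2 y < 2 ^ M.-1 by lia.
by rewrite ltn_exp2l //; lia.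
Qed.

Lemma class_round_mem (top : bool) r l q : l.+1 < M -> q < 2 ^ l ->
  (2 ^ l.+1 + top * 2 ^ l + f (2 ^ l) r q, 2 ^ l + q)
    \in class_round (odd l) top r.
Proof.
move=> lM ql; rewrite -outerE //; apply/mapP; exists (2 ^ l + q) => //.
rewrite mem_filter trunc_log2_shell // eqxx /= mem_iota.
have : 0 < 2 ^ l by rewrite expn_gt0.
have : 2 ^ l.+1 <= 2 ^ M.-1 by rewrite leq_exp2l //; lia.
by rewrite expnS; lia.
Qed.

Lemma mem_class_net par c : c \in class_net par ->
  exists l q q', [/\ l.+1 < M, odd l = par, q < 2 ^ l, q' < 2 ^ l.+1 &
    c = (2 ^ l.+1 + q', 2 ^ l + q)].
Proof.
case/flattenP=> R /allpairsP[[top r] /= [_]]; rewrite mem_iota => rd -> /mem_class_round.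
case=> l [q [lM ol ql ->]]; exists l, q, (top * 2 ^ l + f (2 ^ l) r q).
split; rewrite ?addnA //.
have [/(_ r q) fl _ _] := fP (2 ^ l).
by have := fl rd ql; rewrite expnS; case: top; lia.
Qed.

Lemma class_net_mem (top : bool) r l q : l.+1 < M -> r < d -> q < 2 ^ l ->
  (2 ^ l.+1 + top * 2 ^ l + f (2 ^ l) r q, 2 ^ l + q) \in class_net (odd l).
Proof.
move=> lM rd ql; apply/flattenP; exists (class_round (odd l) top r).
  by apply/allpairsP; exists (top, r); rewrite /= mem_iota rd; case: top; rewrite !inE.
exact: class_round_mem.
Qed.

Lemma class_net_disjoint par c1 c2 :
  c1 \in class_net par -> c2 \in class_net par -> c1.1 != c2.2.
Proof.
move=> /mem_class_net[l [q [q' [_ ol ql ql' ->]]]].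
move=> /mem_class_net[l2 [q2 [q2' [_ ol2 ql2 ql2' ->]]]] /=.
apply/eqP => /(congr1 (trunc_log 2)); rewrite !trunc_log2_shell // => E.
by move: ol2; rewrite -E /= ol; case: (par).
Qed.

Lemma push_class_out par b p : 2 ^ M <= p -> push (class_net par) b p = b p.
Proof.
move=> pM; rewrite /push run_net_out // mem_cat; apply/negP.
have pow l : l.+1 < M -> 2 ^ l.+2 <= 2 ^ M by move=> lM; rewrite leq_exp2l.
by case/orP=> /mapP[c /mem_class_net[l [q [q' [/pow]]]]];
  rewrite !expnS => lM _ ql ql' -> /=; lia.
Qed.

(** Levels of equal parity differ by at least 2, so no comparator of the class leaves the union of
    the two shells. *)
Lemma shell_count_class par b l : odd l = par ->
  let b' := push (class_net par) b in
  shell_count b' l + shell_count b' l.+1 = shell_count b l + shell_count b l.+1.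
Proof.
move=> ol b'.
have E c : shell_count c l + shell_count c l.+1 = count c (iota (2 ^ l) (2 ^ l + 2 ^ l.+1)).
  by rewrite iotaD count_cat addnn -mul2n -expnS.
rewrite !E; apply: push_count; first exact: iota_uniq.
move=> c /mem_class_net[l' [q [q' [lM ol' ql ql' ->]]]] /=; rewrite !mem_iota.
have [lt|gt|E'] := ltngtP l l'.
- have lt2 : l.+2 <= l'.
    rewrite ltn_neqAle lt andbT; apply: contra_eq_neq ol' => <- /=.
    by rewrite ol; case: (par).
  have : 2 ^ l.+2 <= 2 ^ l' by rewrite leq_exp2l.
  by move: ql ql'; rewrite !expnS; lia.
- have gt2 : l'.+2 <= l.
    rewrite ltn_neqAle gt andbT; apply: contra_eq_neq ol => <- /=.
    by rewrite ol'; case: (par).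
  have : 2 ^ l'.+2 <= 2 ^ l by rewrite leq_exp2l.
  by move: ql ql'; rewrite !expnS; lia.
by move: ql ql'; rewrite -E' !expnS; lia.
Qed.

Lemma core_count_class par b l : odd l != par ->
  core_count (push (class_net par) b) l.+1 = core_count b l.+1.
Proof.
move=> ol; apply: push_count; first exact: iota_uniq.
move=> c /mem_class_net[l' [q [q' [lM ol' ql ql' ->]]]] /=; rewrite !mem_iota.
have [lt|gt|E'] := ltngtP l l'; last by rewrite E' ol' eqxx in ol.
  have : 2 ^ l.+1 <= 2 ^ l' by rewrite leq_exp2l.
  by move: ql ql'; rewrite !expnS; lia.
have : 2 ^ l'.+2 <= 2 ^ l.+1 by rewrite leq_exp2l.
by move: ql ql'; rewrite !expnS; lia.
Qed.

(** By [push_final], all inner partners of a position that stays bad are bad. Hence each half of the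
    outer shell has at most 1/256 as many bad positions as the inner shell, and the two halves
    together at most 1/128. Beyond [2 ^ M] nothing is bad. *)
Lemma shell_count_contract b l :
  let b' := push (class_net (odd l)) b in
  (forall p, 2 ^ M <= p -> ~~ b p) ->
  128 * shell_count b' l <= 127 * 2 ^ l ->
  128 * shell_count b' l.+1 <= shell_count b' l.
Proof.
move=> b' bM Hl.
have [lM|Ml] := ltnP l.+1 M; last first.
  rewrite (_ : shell_count b' l.+1 = 0) // /shell_count; apply/eqP.
  rewrite -leqn0 leqNgt -has_count; apply/hasPn => p; rewrite mem_iota => /andP[lp _].
  have Mp : 2 ^ M <= p by apply: leq_trans lp; rewrite leq_exp2l.
  by rewrite /b' push_class_out // bM.
have key (top : bool) :
    256 * count b' (iota (2 ^ l.+1 + top * 2 ^ l) (2 ^ l)) <= shell_count b' l.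
  have [_ _ H] := fP (2 ^ l).
  have {}H := H (fun q => b' (2 ^ l.+1 + top * 2 ^ l + q)) (fun q => b' (2 ^ l + q)).
  rewrite /shell_count (count_iota_shift b' (2 ^ l)).
  rewrite (count_iota_shift b' (2 ^ l.+1 + _)); apply: H; last by rewrite -count_iota_shift.
  move=> r q rd ql.
  by have /(push_final (@class_net_disjoint _)) := class_net_mem top lM rd ql; apply.
have := key false; have := key true; rewrite mul0n mul1n addn0.
have -> : shell_count b' l.+1 = count b' (iota (2 ^ l.+1) (2 ^ l)) +
    count b' (iota (2 ^ l.+1 + 2 ^ l) (2 ^ l)).
  by rewrite -count_cat -iotaD addnn -mul2n -expnS.
by lia.
Qed.

End Class.
End Splitter.

(** * Decay of the misplaced counts *)

Definition profile b h j := if j is i.+1 then shell_count b (h + i) else core_count b h.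

(** The effect of one parity class on a profile. An index that is inner in its pair may gain the
    load of the next one; an outer index contracts unless the inner shell may become nearly full.
    [V i] is twice the size of that inner shell, whence 256 against 127. For [i = 0] the inner shell
    is the outermost one of the core. *)
Definition half_step (V : nat -> nat) h par (x x' : nat -> nat) :=
  [/\ forall j, odd (h + j) != par -> x' j <= x j + x j.+1,
      forall i, odd (h + i.+1) = par -> 256 * (x i + x i.+1) <= 127 * V i ->
        128 * x' i.+1 <= x i + x i.+1 &
      odd h = par -> x' 0 = x 0].

(* [R i] is the reciprocal of the permitted number of misplaced elements in shell [h + i], in
   units of [V 0 = 2 ^ h]; a pair of half steps gains a factor 4. *)
Lemma two_half_steps h par (R V : nat -> nat) (x x1 x2 : nat -> nat) :
  32 <= R 0 -> (forall i, R i.+1 = 8 * R i) -> (forall i, 2 * V 0 <= V i.+1) ->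
  half_step V h par x x1 -> half_step V h (~~ par) x1 x2 ->
  (forall i, R i * x i.+1 <= V 0) -> R 0 * x 0 <= 9 * V 0 ->
  (forall i, 4 * (R i * x2 i.+1) <= V 0) /\
  8 * (R 0 * x2 0) <= 8 * (R 0 * x 0) + 9 * V 0.
Proof.
move=> R32 RS VS [in1 out1 z1] [in2 out2 z2] Hx H0.
have R256 i : 256 <= R i.+1 by elim: i => [|i IH]; rewrite RS; lia.
(* After the first half step the load scaled by [R i] is at most 9/8 of [V 0] for an inner shell and
   10/128 for an outer one. *)
have i1 i : odd (h + i.+1) != par -> 8 * (R i * x1 i.+1) <= 9 * V 0.
  move=> /in1; have := Hx i; have := Hx i.+1; rewrite RS.
  by move: (R i) (x1 _) (x _) (x _) (V 0) => ? ? ? ? ?; nia.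
have o1 i : odd (h + i.+1) = par -> 128 * (R i * x1 i.+1) <= 10 * V 0.
  move=> /out1; case: i => [|i].
    move: H0 R32 (Hx 0); move: (R 0) (x1 _) (x _) (x _) (V 0) => r y' y z v h1 r32 h2 h3.
    have h4 : r * (z + y) <= 10 * v by lia.
    have h5 : 32 * (z + y) <= r * (z + y) by rewrite leq_mul2r r32 orbT.
    have {}h3 : 128 * y' <= z + y by apply: h3; lia.
    by have := leq_mul (leqnn r) h3; lia.
  have := Hx i; have := Hx i.+1; have := VS i; have := R256 i; rewrite RS.
  move: (V 0) (V i.+1) (R i) (x1 _) (x _) (x _) => v v' r y' y z r32 vv h1 h2 h3.
  have h4 : 8 * r * (y + z) <= 9 * v by lia.
  have h5 : 256 * (y + z) <= 8 * r * (y + z) by rewrite leq_mul2r r32 orbT.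
  have {}h3 : 128 * y' <= y + z by apply: h3; lia.
  by have := leq_mul (leqnn (8 * r)) h3; lia.
have opp i : (odd (h + i.+1) == par) = (odd (h + i) != par).
  by rewrite addnS /=; case: odd; case: (par).
split=> [i|]; last first.
  have := Hx 0; have := in1 0; have := in2 0; have := i1 0.
  rewrite opp addn0 negbK; move: z1 z2; case: (odd h); case: (par) => //= z1 z2.
  - move=> /(_ isT) + /(_ isT); rewrite -z1 // => A B _ _.
    by have := leq_mul (leqnn (R 0)) B; lia.
  - by move=> _ _ /(_ isT) A B; rewrite z2 //; have := leq_mul (leqnn (R 0)) A; lia.
  - by move=> _ _ /(_ isT) A B; rewrite z2 //; have := leq_mul (leqnn (R 0)) A; lia.
  move=> /(_ isT) + /(_ isT); rewrite -z1 // => A B _ _.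
  by have := leq_mul (leqnn (R 0)) B; lia.
(* A shell first outer and then inner ends with at most $10/128 + 9/64 < 1/4$; one first inner and
   then outer with at most $(10 + 9/8)/128 < 1/4$. *)
have [/eqP oi|oi] := boolP (odd (h + i.+1) == par).
  have ni : odd (h + i.+1) != ~~ par by rewrite oi; case: (par).
  move: (i1 i.+1) (in2 _ ni) (o1 _ oi).
  rewrite addnS /= oi; case: (par) => /(_ isT); rewrite RS;
    move: (V 0) (R i) (x1 _) (x1 _) (x2 _) => v r y z w h1 h2 h3;
    by have := leq_mul (leqnn r) h2; lia.
have oi' : odd (h + i.+1) = ~~ par by move: oi; case: odd; case: (par).
have := out2 _ oi'; have := i1 _ oi; move: oi; rewrite opp negbK => /eqP oi.
have A : 8 * (R i * x1 i) <= 80 * V 0.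
  case: i oi {oi'} => [|i] oi; last by have := o1 _ oi; rewrite RS; lia.
  by move: oi; rewrite addn0 => /z1 ->; lia.
have B : V 0 <= V i by case: (i) => [|j]; [lia|have := VS j; lia].
have C : 32 <= R i by case: (i) => // j; have := R256 j; lia.
move: A B C; move: (V 0) (V i) (R i) (x1 _) (x1 _) (x2 _) => v v' r y z w A B C h1 h2.
have D : 32 * (z + y) <= r * (z + y) by rewrite leq_mul2r C orbT.
have {}h2 : 128 * w <= z + y by apply: h2; lia.
by have := leq_mul (leqnn r) h2; lia.
Qed.

(** The shells add at most $\sum_i 2^h/(512 \cdot 2^i) \le 2^h/256$; the decay $8^{-i}$ is only used
    as $2^{-i}$. *)
Lemma core_count_shells b h k : (forall i, 512 * 8 ^ i * shell_count b (h + i) <= 2 ^ h) ->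
  256 * core_count b (h + k) <= 256 * core_count b h + 2 ^ h.
Proof.
move=> H.
suff : 2 ^ k * (256 * core_count b (h + k)) + 2 ^ h <= 2 ^ k * (256 * core_count b h + 2 ^ h).
  by move=> /(leq_trans (leq_addr _ _)); rewrite leq_pmul2l ?expn_gt0.
elim: k => [|k IH]; first by rewrite addn0 !mul1n.
have : 512 * 2 ^ k * shell_count b (h + k) <= 2 ^ h.
  by apply: leq_trans (H k); rewrite leq_mul2r leq_mul2l leq_expn ?orbT.
move: IH; rewrite addnS core_countS expnS.
by move: (2 ^ k) (2 ^ h) (core_count _ _) (core_count _ _) (shell_count _ _) => *; lia.
Qed.

Section Splitter.

Variables (d : nat) (f : nat -> nat -> nat -> nat).
Hypothesis fP : forall b, expander 256 128 d b (f b).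

Lemma half_step_profile M h par b : 0 < h -> (forall p, 2 ^ M <= p -> ~~ b p) ->
  half_step (fun i => 2 ^ (h + i)) h par
    (profile b h) (profile (push (class_net d f M par) b) h).
Proof.
case: h => // l _ bM; split.
- case=> [|i]; rewrite ?addn0 /profile.
    by move=> /(core_count_class fP M b); rewrite !core_countS addn0; lia.
  rewrite addnS; move: (l.+1 + i) => L oi; have oL : odd L = par.
    by move: oi; rewrite /=; case: odd; case: (par).
  by have /= := shell_count_class fP M b oL; lia.
- move=> i oi Hi; have oi' : odd (l + i) = par by rewrite -oi !(addSn, addnS) /= negbK.
  have := shell_count_class fP M b oi'; rewrite -oi' => /= E.
  have x0 : shell_count b (l + i) <= profile b l.+1 i.
    by case: (i) => [|j]; rewrite /profile ?addn0 ?shell_count_core // addnS.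
  rewrite /profile -/(profile b l.+1 i) in Hi *.
  have := @shell_count_contract _ _ fP M b (l + i) bM.
  rewrite addSn expnS in Hi; rewrite addSn /= => C.
  apply: leq_trans (C _) _; first by move: Hi E x0; case: (i) => *; lia.
  by move: E x0; case: (i) => *; lia.
- by move=> ol; rewrite /profile core_count_class //= -ol /=; case: odd.
Qed.

(** * Exchange between the left and the right core *)

Section Center.

Variable h : nat.

(* Both orientations of the expander are used, so that it expands from either side. *)
Definition center_rounds : seq (seq (pos * pos)) :=
  [seq [seq ((false, f (2 ^ h) r q), (true, q)) | q <- iota 0 (2 ^ h)] | r <- iota 0 d] ++
  [seq [seq ((false, q), (true, f (2 ^ h) r q)) | q <- iota 0 (2 ^ h)] | r <- iota 0 d].

Definition center_net := flatten center_rounds.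

Lemma mem_center_net c : c \in center_net ->
  exists p q, [/\ p < 2 ^ h, q < 2 ^ h & c = ((false, p), (true, q))].
Proof.
have [fl _ _] := fP (2 ^ h).
case/flattenP=> R; rewrite mem_cat => /orP[] /mapP[r]; rewrite mem_iota => rd -> /mapP[q].
  by rewrite mem_iota => qh ->; exists (f (2 ^ h) r q), q; rewrite fl.
by rewrite mem_iota => qh ->; exists q, (f (2 ^ h) r q); rewrite fl.
Qed.

Lemma center_net_mem r q : r < d -> q < 2 ^ h ->
  (((false, f (2 ^ h) r q), (true, q)) \in center_net) &&
  (((false, q), (true, f (2 ^ h) r q)) \in center_net).
Proof.
move=> rd qh; apply/andP; split; apply/flattenP.
  exists [seq ((false, f (2 ^ h) r q), (true, q)) | q <- iota 0 (2 ^ h)].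
    by rewrite mem_cat; apply/orP; left; apply/mapP; exists r; rewrite ?mem_iota.
  by apply/mapP; exists q; rewrite ?mem_iota.
exists [seq ((false, q), (true, f (2 ^ h) r q)) | q <- iota 0 (2 ^ h)].
  by rewrite mem_cat; apply/orP; right; apply/mapP; exists r; rewrite ?mem_iota.
by apply/mapP; exists q; rewrite ?mem_iota.
Qed.

Lemma push_center_out b s p : 2 ^ h <= p -> push center_net b (s, p) = b (s, p).
Proof.
move=> hp; rewrite /push run_net_out // mem_cat; apply/negP => /orP[] /mapP[c];
  by case/mem_center_net => x [y [xh yh ->]] /= [_ E]; rewrite E leqNgt ?xh ?yh in hp.
Qed.

Lemma core_count_true b :
  count (fun p => b (true, p)) (iota 0 (2 ^ h)) + core_count (bad true b) h = 2 ^ h.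
Proof.
rewrite -[RHS](size_iota 0) -(count_predC (fun p => b (true, p))); congr (_ + _).
by apply: eq_count => p; rewrite /bad addbT.
Qed.

(** The number of ones in the two cores is preserved, so the difference between left and right bad
    counts is invariant. *)
Lemma center_balance b (b' := push center_net b) :
  core_count (bad false b') h + core_count (bad true b) h =
  core_count (bad false b) h + core_count (bad true b') h.
Proof.
pose side s := [seq (s, p) : pos | p <- iota 0 (2 ^ h)].
have mside s s' p : ((s, p) \in side s') = (s == s') && (p < 2 ^ h).
  apply/mapP/andP => [[q qh [-> ->]]|[/eqP-> ph]].
    by rewrite eqxx; move: qh; rewrite mem_iota.
  by exists p; rewrite ?mem_iota.
have uside s : uniq (side s) by rewrite map_inj_uniq ?iota_uniq // => ? ? [].
have E : count b' (side false ++ side true) = count b (side false ++ side true).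
  apply: push_count => [|c /mem_center_net[p [q [ph qh ->]]]].
    rewrite cat_uniq !uside andbT; apply/hasPn => -[s p]; rewrite /= !mside.
    by case: s.
  by rewrite !mem_cat !mside /= ph qh.
have sideE c : count c (side false ++ side true) + core_count (bad true c) h =
    core_count (bad false c) h + 2 ^ h.
  rewrite count_cat -addnA -(core_count_true c) !count_map; congr (_ + _).
  by apply: eq_count => p; rewrite /bad addbF.
have Eb : @count pos b (side false ++ side true) + core_count (bad true b') h =
    core_count (bad false b') h + 2 ^ h by rewrite -sideE; congr (_ + _); exact/esym.
by have := sideE b; lia.
Qed.

(** If a position of side [s] is still bad at the end, all its partners on the other side are good;
    [t] counts the good positions there. *)
Lemma center_expand b s (b' := push center_net b) (t := 2 ^ h - core_count (bad (~~ s) b') h) :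
  128 * t <= 127 * 2 ^ h -> 256 * core_count (bad s b') h <= t.
Proof.
have [_ _ H] := fP (2 ^ h).
have final c : c \in center_net -> b' c.1 -> b' c.2.
  apply: push_final => c1 c2 /mem_center_net[p [q [_ _ ->]]] /mem_center_net[p' [q' [_ _ ->]]].
  by [].
have -> : t = count (fun p => ~~ bad (~~ s) b' p) (iota 0 (2 ^ h)).
  rewrite /t -[in LHS](size_iota 0 (2 ^ h)) -(count_predC (bad (~~ s) b')) addKn.
  by [].
apply: (H (bad s b') (fun p => ~~ bad (~~ s) b' p)) => r q rd qh.
have /andP[/final /= c1 /final /= c2] := center_net_mem rd qh.
rewrite /bad; case: (s) => /=; rewrite ?addbF ?addbT ?negbK //.
exact: contra.
Qed.

Lemma core_count_outer b M : h <= M ->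
  core_count b M = core_count b h + count b (iota (2 ^ h) (2 ^ M - 2 ^ h)).
Proof.
by move=> hM; rewrite /core_count -count_cat -iotaD subnKC // leq_exp2l.
Qed.

Lemma center_core M b (b' := push center_net b) s : h <= M ->
  core_count (bad s b') M + core_count (bad s b) h =
  core_count (bad s b) M + core_count (bad s b') h.
Proof.
move=> hM; rewrite !(core_count_outer _ hM).
have -> : count (bad s b') (iota (2 ^ h) (2 ^ M - 2 ^ h)) =
    count (bad s b) (iota (2 ^ h) (2 ^ M - 2 ^ h)).
  by apply: eq_in_count => p; rewrite mem_iota => /andP[hp _]; rewrite /bad /b' push_center_out.
by lia.
Qed.

(** Either expansion applies and at most $2^h/256$ positions of side [s] stay bad, or fewer than
    $2^h/128$ positions of the other side are bad. In the second case balance transfers the bound,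
    since the two core counts differ by at most $2^h/256$. *)
Lemma center_bound M b (b' := push center_net b) : h <= M ->
  core_count (bad false b) M = core_count (bad true b) M ->
  (forall s, 256 * core_count (bad s b) M <= 256 * core_count (bad s b) h + 2 ^ h) ->
  forall s, 64 * core_count (bad s b') h <= 2 ^ h.
Proof.
move=> hM bal H s.
have := center_core b false hM; have := center_core b true hM; rewrite -/b'.
have := core_count_leq (bad false b') h; have := core_count_leq (bad true b') h.
have := center_balance b; have := center_expand (b := b) (s := s); rewrite -/b'.
have mono c : core_count c h <= core_count c M by rewrite (core_count_outer _ hM) leq_addr.
have := mono (bad false b); have := mono (bad true b).
have := H false; have := H true.
by case: s => /=; lia.
Qed.

End Center.
End Splitter.

(** * Stages and correctness of the splitting network *)

Section Splitter.

Variables (d : nat) (f : nat -> nat -> nat -> nat).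
Hypothesis fP : forall b, expander 256 128 d b (f b).
Variable M : nat.

Definition side_rounds (cl : seq (seq (nat * nat))) :=
  map (side_net false) cl ++ map (side_net true) cl.

Definition sweep_rounds :=
  side_rounds (class_rounds d f M false) ++ side_rounds (class_rounds d f M true).

Definition stage_rounds h := sweep_rounds ++ sweep_rounds ++ center_rounds d f h.

Definition split_rounds :=
  center_rounds d f M ++ flatten [seq stage_rounds h | h <- rev (iota 1 M.-1)].

Lemma bad_side_rounds s cl b :
  bad s (push (flatten (side_rounds cl)) b) =1 push (flatten cl) (bad s b).
Proof.
move=> p; rewrite /side_rounds flatten_cat /push run_net_cat -!/(push _ _).
have E s' : flatten (map (side_net s') cl) = side_net s' (flatten cl).
  by rewrite /side_net map_flatten.
rewrite !E.
case: s.
  by rewrite bad_side_net; apply: push_ext => q; rewrite bad_side_netN.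
by rewrite bad_side_netN // bad_side_net.
Qed.

Lemma bad_sweep s b : bad s (push (flatten sweep_rounds) b) =1
  push (class_net d f M true) (push (class_net d f M false) (bad s b)).
Proof.
move=> p; rewrite /sweep_rounds flatten_cat /push run_net_cat -!/(push _ _).
by rewrite bad_side_rounds; apply: push_ext => q; rewrite bad_side_rounds.
Qed.

Lemma eq_core_count b1 b2 h : b1 =1 b2 -> core_count b1 h = core_count b2 h.
Proof. by move=> E; apply: eq_count. Qed.

Lemma eq_shell_count b1 b2 h : b1 =1 b2 -> shell_count b1 h = shell_count b2 h.
Proof. by move=> E; apply: eq_count. Qed.

Lemma core_count_class_full par b :
  core_count (push (class_net d f M par) b) M = core_count b M.
Proof.
apply: push_count; first exact: iota_uniq.
move=> c /(mem_class_net fP)[l [q [q' [lM ol ql ql' ->]]]] /=; rewrite !mem_iota.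
have : 2 ^ l.+2 <= 2 ^ M by rewrite leq_exp2l.
by move: ql ql'; rewrite !expnS; lia.
Qed.

Definition admissible (b : pos -> bool) :=
  (forall s p, 2 ^ M <= p -> ~~ bad s b p) /\
  core_count (bad false b) M = core_count (bad true b) M.

(* The bound on shell [h + i] is a fraction 16^(-i) / 512 of its size. *)
Definition stage_inv h (b : pos -> bool) := forall s,
  (forall i, 512 * 8 ^ i * shell_count (bad s b) (h + i) <= 2 ^ h) /\
  64 * core_count (bad s b) h <= 2 ^ h.

Lemma admissible_sweep b : admissible b -> admissible (push (flatten sweep_rounds) b).
Proof.
case=> bM bal; split=> [s p Mp|].
  by rewrite bad_sweep !(push_class_out fP) // bM.
by rewrite !(eq_core_count _ (bad_sweep _ _)) !core_count_class_full.
Qed.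

Lemma admissible_center h b : h <= M -> admissible b ->
  admissible (push (center_net d f h) b).
Proof.
move=> hM [bM bal]; split=> [s p Mp|].
  rewrite /bad (push_center_out fP) -/(bad s b p) ?bM //.
  by apply: leq_trans Mp; rewrite leq_exp2l.
have := center_core fP b false hM; have := center_core fP b true hM.
by have := center_balance fP h b; rewrite /=; lia.
Qed.

Lemma stage_inv_center h b : h <= M -> admissible b ->
  (forall s i, 512 * 8 ^ i * shell_count (bad s b) (h + i) <= 2 ^ h) ->
  stage_inv h (push (center_net d f h) b).
Proof.
move=> hM [bM bal] H s; split=> [i|].
  rewrite (_ : shell_count _ _ = shell_count (bad s b) (h + i)) //.
  apply: eq_in_count => p; rewrite mem_iota => /andP[hp _].
  rewrite /bad (push_center_out fP) //; apply: leq_trans hp.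
  by rewrite leq_exp2l // leq_addr.
apply: (center_bound fP hM bal) => s'.
by have := core_count_shells (M - h) (H s'); rewrite subnKC.
Qed.

Lemma sweep_bounds h Q s b : 0 < h -> 32 <= Q -> (forall p, 2 ^ M <= p -> ~~ bad s b p) ->
  let x := profile (bad s b) h in
  let x' := profile (bad s (push (flatten sweep_rounds) b)) h in
  (forall i, Q * 8 ^ i * x i.+1 <= 2 ^ h) -> Q * x 0 <= 9 * 2 ^ h ->
  (forall i, 4 * (Q * 8 ^ i * x' i.+1) <= 2 ^ h) /\
  8 * (Q * x' 0) <= 8 * (Q * x 0) + 9 * 2 ^ h.
Proof.
move=> h0 Q32 bM x x' Hx H0.
have bM' p : 2 ^ M <= p -> ~~ push (class_net d f M false) (bad s b) p.
  by move=> Mp; rewrite (push_class_out fP) // bM.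
have s1 := half_step_profile fP false h0 bM.
have s2 := half_step_profile fP true h0 bM'.
have E j : x' j =
    profile (push (class_net d f M true) (push (class_net d f M false) (bad s b))) h j.
  by case: j => [|j]; [apply: eq_core_count|apply: eq_shell_count]; apply: bad_sweep.
have := @two_half_steps h false (fun i => Q * 8 ^ i) _ _ _ _ _ _ _ s1 s2.
rewrite expn0 muln1 addn0 E; case=> //.
- by move=> i; rewrite expnS; lia.
- by move=> i; rewrite addnS -expnS leq_exp2l // ltnS leq_addr.
by move=> H1 H2; split=> // i; rewrite E.
Qed.

Lemma stage_step h b : 0 < h -> h < M -> admissible b -> stage_inv h.+1 b ->
  admissible (push (flatten (stage_rounds h)) b) /\
  stage_inv h (push (flatten (stage_rounds h)) b).
Proof.
move=> h0 hM adm inv.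
rewrite /push /stage_rounds 2!(flatten_cat sweep_rounds).
rewrite 2!(run_net_cat _ (flatten sweep_rounds)).
rewrite -!/(push _ _) -!/(center_net _ _ _).
have adm1 := admissible_sweep adm; have adm2 := admissible_sweep adm1.
split; first exact: admissible_center (ltnW hM) adm2.
apply: stage_inv_center (ltnW hM) adm2 _ => s i.
have [shells core] := inv s.
rewrite core_countS expnS in core.
(* Measured against $2^h$, the invariant for [h.+1] holds with 32 in place of 512, and each sweep
   gains a factor 4: 32, 128, 512. The scaled core load, at most 1 at the start, is at most 17/8
   after one sweep, which is $17/2 \le 9$ in the units of [Q = 128]. *)
have Q0 : forall i, 32 * 8 ^ i * profile (bad s b) h i.+1 <= 2 ^ h.
  case=> [|j]; rewrite /profile; first by rewrite addn0 expn0; lia.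
  by have := shells j; rewrite addSnnS !expnS; lia.
have [] := sweep_bounds h0 (leqnn 32) (adm.1 s) Q0 _; first by rewrite /profile; lia.
move=> Q1 C1.
have [] := sweep_bounds (Q := 128) h0 isT (adm1.1 s) _ _.
- by move=> j; have := Q1 j; lia.
- by move: C1; rewrite /profile; lia.
by move=> /(_ i) Q2 _; move: Q2; rewrite /profile; lia.
Qed.

Lemma split_rounds_correct b s p : 0 < M -> admissible b ->
  ~~ bad s (push (flatten split_rounds) b) p.
Proof.
move=> M0 adm.
have stages k b' : k < M -> admissible b' -> stage_inv k.+1 b' ->
    let b'' := push (flatten (flatten [seq stage_rounds h | h <- rev (iota 1 k)])) b' in
    admissible b'' /\ stage_inv 1 b''.
  elim: k b' => [|k IH] b' kM adm' inv //.
  have [adm'' inv''] := stage_step (isT : 0 < k.+1) kM adm' inv.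
  have := IH _ (ltnW kM) adm'' inv''.
  have -> : rev (iota 1 k.+1) = k.+1 :: rev (iota 1 k).
    by rewrite -{1}(addn1 k) iotaD rev_cat add1n.
  by rewrite /= (flatten_cat (stage_rounds k.+1)) /push run_net_cat.
have adm0 := admissible_center (leqnn M) adm.
(* No bad position lies in a shell from [M] on, so the first exchange alone establishes the
   invariant. *)
have inv0 : stage_inv M (push (center_net d f M) b).
  apply: stage_inv_center => // s' i; rewrite (_ : shell_count _ _ = 0) ?muln0 //.
  apply/eqP; rewrite -leqn0 leqNgt -has_count; apply/hasPn => q.
  rewrite mem_iota => /andP[qM _]; apply: adm.1.
  by apply: leq_trans qM; rewrite leq_exp2l // leq_addr.
have := stages M.-1 _ _ adm0; rewrite prednK // => /(_ (leqnn _) inv0).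
have -> : push (flatten split_rounds) b =
    push (flatten (flatten [seq stage_rounds h | h <- rev (iota 1 M.-1)]))
      (push (center_net d f M) b).
  by rewrite /split_rounds (flatten_cat (center_rounds d f M)) /push run_net_cat.
set b'' := push (flatten (flatten _)) _ => -[[out _] /(_ s) [shells core]].
have [Mp|pM] := leqP (2 ^ M) p; first exact: out.
(* At [h = 1] the core bound $2/64$ forces an empty core count, and then $256 \cdot$ total $\le 2$
   forces the total to be 0. *)
have := core_count_shells M.-1 shells; rewrite add1n prednK // => H.
have {}H : core_count (bad s b'') M = 0 by lia.
apply/negP => bp; have := has_count (bad s b'') (iota 0 (2 ^ M)).
rewrite -/(core_count _ _) H => /hasP; apply; exists p => //.
by rewrite mem_iota.
Qed.

Lemma size_split_rounds : 0 < M -> size split_rounds <= 18 * d * M.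
Proof.
move=> M0.
have sc par : size (class_rounds d f M par) = 2 * d by rewrite size_allpairs size_iota.
have sce h : size (center_rounds d f h) = 2 * d.
  by rewrite size_cat !size_map !size_iota; lia.
(* Two sweeps of [8 * d] rounds each, then [2 * d] rounds in the center. *)
have ss h : size (stage_rounds h) = 18 * d.
  have side cl : size (side_rounds cl) = 2 * size cl by rewrite size_cat !size_map; lia.
  by rewrite /stage_rounds 2!(size_cat sweep_rounds) sce size_cat !side !sc; lia.
rewrite /split_rounds (size_cat (center_rounds d f M)) sce size_flatten.
rewrite sumnE /shape -map_comp big_map.
under eq_bigr => h _ do rewrite /= ss.
by rewrite big_const_seq count_predT iter_addn addn0 size_rev size_iota; nia.
Qed.

(** Every round is a matching, so it costs an element at most one comparison: each [f b r] is
    injective, and inner and outer shells of a class have opposite parities. *)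
Lemma split_rounds_uniq R : R \in split_rounds -> uniq (unzip1 R ++ unzip2 R).
Proof.
have fI r : r < d -> forall h, {in iota 0 (2 ^ h) &, injective (f (2 ^ h) r)}.
  by move=> rd h q q'; rewrite !mem_iota => qh qh'; have [_ H _] := fP (2 ^ h); apply: H.
have center h : R \in center_rounds d f h -> uniq (unzip1 R ++ unzip2 R).
  rewrite mem_cat => /orP[] /mapP[r]; rewrite mem_iota => rd ->.
    rewrite /unzip1 /unzip2 -!map_comp cat_uniq; apply/and3P; split.
    - by rewrite map_inj_in_uniq ?iota_uniq // => q q' qi qi' [] /(fI r rd h); apply.
    - by apply/hasPn => _ /mapP[q _ ->]; apply/mapP => -[].
    - by rewrite map_inj_uniq ?iota_uniq // => q q' [].
  rewrite /unzip1 /unzip2 -!map_comp cat_uniq; apply/and3P; split.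
  - by rewrite map_inj_uniq ?iota_uniq // => q q' [].
  - by apply/hasPn => _ /mapP[q _ ->]; apply/mapP => -[].
  - by rewrite map_inj_in_uniq ?iota_uniq // => q q' qi qi' [] /(fI r rd h); apply.
have class par R' : R' \in class_rounds d f M par -> uniq (unzip1 R' ++ unzip2 R').
  move=> R'in.
  have sub c : c \in R' -> c \in class_net d f M par by move=> cR; apply/flattenP; exists R'.
  rewrite cat_uniq; apply/and3P; split.
  - case/allpairsP: R'in => -[top r] /= [_]; rewrite mem_iota => rd ->.
    rewrite /unzip1 -map_comp map_inj_in_uniq ?filter_uniq ?iota_uniq // => y y'.
    rewrite !mem_filter !mem_iota.
    move=> /andP[_ /andP[/shellP[q ql yE] _]] /andP[_ /andP[/shellP[q' ql' yE'] _]] /=.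
    move: (trunc_log 2 y) (trunc_log 2 y') ql yE ql' yE' => l l' ql -> ql' -> {y y'}.
    rewrite !outerE // -!addnA => E.
    have lt (k : bool) l1 q1 : q1 < 2 ^ l1 -> k * 2 ^ l1 + f (2 ^ l1) r q1 < 2 ^ l1.+1.
      by have [fl _ _] := fP (2 ^ l1); move=> /(fl r _ rd); rewrite expnS; case: k; lia.
    have /succn_inj El : l.+1 = l'.+1.
      by rewrite -(trunc_log2_shell (lt top _ _ ql)) E trunc_log2_shell // lt.
    move: ql' E; rewrite -El => ql' /addnI/addnI Ef; congr (_ + _).
    by apply: (fI r rd l) => //; rewrite mem_iota.
  - apply/hasPn => _ /mapP[c cR ->]; apply/mapP => -[c' c'R E].
    by have := class_net_disjoint fP (sub _ c'R) (sub _ cR); rewrite -E eqxx.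
  - case/allpairsP: R'in => -[top r] /= [_ _ ->].
    by rewrite /unzip2 -map_comp map_id filter_uniq ?iota_uniq.
have side s R' : uniq (unzip1 R' ++ unzip2 R') ->
    uniq (unzip1 (side_net s R') ++ unzip2 (side_net s R')).
  have inj : injective (pair s : nat -> pos) by move=> ? ? [].
  have perm : perm_eq (unzip1 (side_net s R') ++ unzip2 (side_net s R'))
      (map (pair s) (unzip1 R' ++ unzip2 R')).
    rewrite /unzip1 /unzip2 /side_net map_cat -!map_comp.
    by case: (s); [rewrite perm_catC|].
  by rewrite (perm_uniq perm) map_inj_uniq.
have sides cl : (forall R', R' \in cl -> uniq (unzip1 R' ++ unzip2 R')) ->
    R \in side_rounds cl -> uniq (unzip1 R ++ unzip2 R).
  by move=> H; rewrite mem_cat => /orP[] /mapP[R' /H /side R'u ->].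
have sweep : R \in sweep_rounds -> uniq (unzip1 R ++ unzip2 R).
  by rewrite mem_cat => /orP[]; apply: sides => R'; apply: class.
rewrite mem_cat => /orP[/center //|/flattenP[_ /mapP[h _ ->]]].
by rewrite (mem_cat _ sweep_rounds) (mem_cat _ sweep_rounds) => /or3P[/sweep|/sweep|/center].
Qed.

End Splitter.

(** * Decision trees and selection *)

Section Tree.

Variable n : nat.

(** Leaves may carry any result, so that subroutines compose by [bind] and their costs add. *)
Inductive ctree (X : Type) : Type :=
| Ret of X
| Cmp of 'I_n & 'I_n & ctree X & ctree X.

Arguments Ret {X}. Arguments Cmp {X}.

Fixpoint bind X Y (t : ctree X) (k : X -> ctree Y) : ctree Y :=
  match t with
  | Ret x => k x
  | Cmp i j l r => Cmp i j (bind l k) (bind r k)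
  end.

Fixpoint mapc X Y (g : X -> ctree Y) (s : seq X) : ctree (seq Y) :=
  if s is x :: s' then bind (g x) (fun y => bind (mapc g s') (fun ys => Ret (y :: ys)))
  else Ret [::].

Fixpoint to_dtree (t : ctree 'I_n) : dtree n :=
  match t with
  | Ret i => Leaf i
  | Cmp i j l r => Node i j (to_dtree l) (to_dtree r)
  end.

Variable a : 'I_n -> nat.

Fixpoint result X (t : ctree X) : X :=
  match t with
  | Ret x => x
  | Cmp i j l r => if a i < a j then result l else result r
  end.

Fixpoint cost X (t : ctree X) (e : 'I_n) : nat :=
  match t with
  | Ret _ => 0
  | Cmp i j l r => ((i == e) || (j == e)) + (if a i < a j then cost l e else cost r e)
  end.

Lemma result_bind X Y (t : ctree X) (k : X -> ctree Y) :
  result (bind t k) = result (k (result t)).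
Proof. by elim: t => //= i j l -> r ->; case: ifP. Qed.

Lemma cost_bind X Y (t : ctree X) (k : X -> ctree Y) e :
  cost (bind t k) e = cost t e + cost (k (result t)) e.
Proof. by elim: t => //= i j l -> r ->; rewrite -addnA; case: ifP. Qed.

Lemma result_mapc X Y (g : X -> ctree Y) s : result (mapc g s) = [seq result (g x) | x <- s].
Proof. by elim: s => //= x s IH; rewrite !result_bind IH. Qed.

Lemma cost_mapc X Y (g : X -> ctree Y) s e : cost (mapc g s) e = \sum_(x <- s) cost (g x) e.
Proof.
by elim: s => [|x s IH] /=; rewrite ?big_nil // big_cons !cost_bind IH addn0.
Qed.

Lemma run_to_dtree t : run (to_dtree t) a = result t.
Proof. by elim: t => //= i j l -> r ->. Qed.

Lemma participations_to_dtree t e : participations (to_dtree t) a e = cost t e.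
Proof. by elim: t => //= i j l -> r ->. Qed.

(* [inr false] and [inr true] are paddings below and above every element;
   comparisons with them are free. *)
Definition item := ('I_n + bool)%type.

Definition pad_gt (u v : item) : bool :=
  match u, v with
  | inr true, _ => true
  | _, inr false => true
  | _, _ => false
  end.

Definition item_gt (u v : item) : bool :=
  match u, v with
  | inl i, inl j => ~~ (a i < a j)
  | _, _ => pad_gt u v
  end.

Variable P : eqType.

Fixpoint netc (cs : seq (P * P)) (s : P -> item) : ctree (P -> item) :=
  if cs is c :: cs' then
    match s c.1, s c.2 with
    | inl i, inl j => Cmp i j (netc cs' s) (netc cs' (swp s c.1 c.2))
    | u, v => netc cs' (if pad_gt u v then swp s c.1 c.2 else s)
    end
  else Ret s.

Lemma result_netc cs s : result (netc cs s) = run_net item_gt cs s.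
Proof.
elim: cs s => //= c cs IH s; rewrite /comparator.
case: (s c.1) => [i|u]; case: (s c.2) => [j|v] //=.
by rewrite !IH; case: (a i < a j).
Qed.

Lemma cost_netc_cat cs1 cs2 s e :
  cost (netc (cs1 ++ cs2) s) e =
  cost (netc cs1 s) e + cost (netc cs2 (run_net item_gt cs1 s)) e.
Proof.
rewrite -result_netc -cost_bind; congr (cost _ e).
elim: cs1 s => //= c cs IH s.
by case: (s c.1) => [i|u]; case: (s c.2) => [j|v] //=; rewrite !IH.
Qed.

Definition once (s : P -> item) e := forall p q, s p = inl e -> s q = inl e -> p = q.

Lemma swpE (s : P -> item) x y p :
  swp s x y p = s (if p == x then y else if p == y then x else p).
Proof. by rewrite /swp; case: (p == x) => //; case: (p == y). Qed.

Lemma once_comparator s e c : once s e -> once (comparator item_gt s c) e.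
Proof.
rewrite /comparator; case: ifP => // _ H p q; rewrite !swpE => A B.
move: (H _ _ A B); case: (p =P c.1) => p1; case: (q =P c.1) => q1;
  case: (p =P c.2) => p2; case: (q =P c.2) => q2; congruence.
Qed.

Lemma once_run_net cs s e : once s e -> once (run_net item_gt cs s) e.
Proof. by elim: cs s => //= c cs IH s H; apply/IH/once_comparator. Qed.

Lemma cost_netc_cons c cs s e : cost (netc (c :: cs) s) e <=
  ((s c.1 == inl e) || (s c.2 == inl e)) + cost (netc cs (comparator item_gt s c)) e.
Proof.
rewrite /= /comparator; case: (s c.1) => [i|u]; case: (s c.2) => [j|v] /=; try exact: leq_addl.
by rewrite -if_neg; case: (a i < a j).
Qed.

Lemma cost_netc_away cs s e : (forall p, p \in unzip1 cs ++ unzip2 cs -> s p <> inl e) ->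
  cost (netc cs s) e = 0.
Proof.
elim: cs s => // c cs IH s H; apply/eqP; rewrite -leqn0.
have H1 : s c.1 <> inl e by apply: H; rewrite mem_head.
have H2 : s c.2 <> inl e by apply: H; rewrite !(inE, mem_cat) eqxx !orbT.
apply: leq_trans (cost_netc_cons _ _ _ _) _.
rewrite (introF eqP H1) (introF eqP H2) IH // => p pc.
have Hp : s p <> inl e.
  by apply: H; move: pc; rewrite /= inE !mem_cat inE => /orP[]->; rewrite ?orbT.
by rewrite /comparator; case: ifP => // _; rewrite swpE; do 2 case: ifP => // _.
Qed.

(** After the comparator that involves [e], the element sits at one of its two ends, which the rest
    of the round avoids. *)
Lemma cost_netc_round cs s e : uniq (unzip1 cs ++ unzip2 cs) -> once s e ->
  cost (netc cs s) e <= 1.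
Proof.
elim: cs s => // c cs IH s u o.
have perm : perm_eq (unzip1 (c :: cs) ++ unzip2 (c :: cs))
    [:: c.1, c.2 & unzip1 cs ++ unzip2 cs].
  by rewrite /= perm_cons perm_catC /= perm_cons perm_catC.
move: u; rewrite (perm_uniq perm) => /and3P[n1 n2 u].
apply: leq_trans (cost_netc_cons _ _ _ _) _.
case: (boolP (_ || _)) => /= Hc; last by rewrite IH //; apply: once_comparator.
rewrite cost_netc_away // => p pc.
have p1 : p != c.1 by apply: contraNneq n1 => <-; rewrite inE pc orbT.
have p2 : p != c.2 by apply: contraNneq n2 => <-.
rewrite (_ : comparator _ _ _ _ = s p) => [sp|].
  by case/orP: Hc => /eqP /(o _ _ sp) E; rewrite E eqxx in p1 p2.
by rewrite /comparator; case: ifP => // _; rewrite swpE (negPf p1) (negPf p2).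
Qed.

Lemma cost_netc_rounds rs s e : (forall r, r \in rs -> uniq (unzip1 r ++ unzip2 r)) ->
  once s e -> cost (netc (flatten rs) s) e <= size rs.
Proof.
elim: rs s => // r rs IH s u o; rewrite /= cost_netc_cat -add1n leq_add //.
  by rewrite cost_netc_round // u // mem_head.
apply: IH; last exact: once_run_net.
by move=> r' r'in; rewrite u // inE r'in orbT.
Qed.

End Tree.

Arguments Ret {n X}.
Arguments Cmp {n X}.

Section Rank.

Variables (T : eqType) (a : T -> nat).
Implicit Types ws : seq T.

Definition rank ws i := count (fun j => a j < a i) ws.

Lemma leq_rank ws i j : a i <= a j -> rank ws i <= rank ws j.
Proof. by move=> ij; apply: sub_count => k /= ki; apply: leq_trans ij. Qed.

Lemma ltn_rank ws i j : i \in ws -> a i < a j -> rank ws i < rank ws j.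
Proof.
elim: ws => //= k ws IH; rewrite inE => /predU1P[<-|/IH H] ij.
  by rewrite ltnn ij add0n add1n ltnS leq_rank // ltnW.
have := H ij; case ki : (a k < a i); case kj : (a k < a j); lia.
Qed.

Lemma rank_lt_size ws i : i \in ws -> rank ws i < size ws.
Proof.
move=> iw; rewrite -[size ws](count_predC (fun j => a j < a i)) -addn1 leq_add2l -has_count.
by apply/hasP; exists i; rewrite //= ltnn.
Qed.

Hypothesis inj_a : injective a.

Lemma rank_inj ws i j : i \in ws -> j \in ws -> rank ws i = rank ws j -> i = j.
Proof.
move=> iw jw E; apply: inj_a; apply/eqP; rewrite eqn_leq.
apply/andP; split; rewrite leqNgt; apply/negP.
  by move/(ltn_rank jw); rewrite E ltnn.
by move/(ltn_rank iw); rewrite E ltnn.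
Qed.

(** Ranks are injective on [ws] and below its size, hence a rearrangement of [iota 0 (size ws)]. *)
Lemma count_rank_lt ws r : uniq ws -> r <= size ws ->
  count (fun i => rank ws i < r) ws = r.
Proof.
move=> u rw.
have ur : uniq (map (rank ws) ws).
  by rewrite map_inj_in_uniq // => i j iw jw; apply: rank_inj.
have sub : {subset map (rank ws) ws <= iota 0 (size ws)}.
  by move=> _ /mapP[i iw ->]; rewrite mem_iota rank_lt_size.
have [|_ E] := uniq_min_size ur sub; first by rewrite size_iota size_map.
have perm := uniq_perm ur (iota_uniq _ _) E.
rewrite -[LHS](count_map (rank ws) (fun k => k < r)) (permP perm).
rewrite -(subnKC rw) iotaD count_cat add0n.
rewrite (@eq_in_count _ _ xpredT) => [|k]; last by rewrite mem_iota => /andP[_ ->].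
rewrite count_predT size_iota (@eq_in_count _ _ pred0) ?count_pred0 ?addn0 // => k.
by rewrite mem_iota => /andP[rk _]; rewrite ltnNge rk.
Qed.

End Rank.

(** * Splitting a set of elements at a given rank *)

Section Split.

Variables (d : nat) (f : nat -> nat -> nat -> nat).
Hypothesis fP : forall b, expander 256 128 d b (f b).
Variables (n M : nat).

Definition positions : seq pos :=
  [seq (false, p) | p <- iota 0 (2 ^ M)] ++ [seq (true, p) | p <- iota 0 (2 ^ M)].

Lemma mem_positions x : (x \in positions) = (x.2 < 2 ^ M).
Proof.
case: x => s p; rewrite mem_cat; apply/orP/idP => [[] /mapP[q]|/= pM].
- by rewrite mem_iota => qM [_ ->].
- by rewrite mem_iota => qM [_ ->].
by case: s; [right|left]; apply/mapP; exists p; rewrite ?mem_iota.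
Qed.

Lemma positions_uniq : uniq positions.
Proof.
rewrite cat_uniq !map_inj_uniq ?iota_uniq ?andbT //=; try by move=> ? ? [].
by apply/hasPn => _ /mapP[p _ ->]; apply/mapP => -[].
Qed.

Lemma mem_split_net c : c \in flatten (split_rounds d f M) -> c.1.2 < 2 ^ M /\ c.2.2 < 2 ^ M.
Proof.
have center h : h <= M -> c \in flatten (center_rounds d f h) -> c.1.2 < 2 ^ M /\ c.2.2 < 2 ^ M.
  move=> hM /(mem_center_net fP)[p [q [ph qh ->]]] /=.
  by split; [apply: leq_trans ph _|apply: leq_trans qh _]; rewrite leq_exp2l.
have side par s : c \in side_net s (class_net d f M par) -> c.1.2 < 2 ^ M /\ c.2.2 < 2 ^ M.
  case/mapP => c' /(mem_class_net fP)[l [q [q' [lM _ ql ql' ->]]]] ->.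
  have : 2 ^ l.+2 <= 2 ^ M by rewrite leq_exp2l.
  by case: s; rewrite /= !expnS; move: ql ql'; rewrite !expnS; lia.
have sides par : c \in flatten (side_rounds (class_rounds d f M par)) ->
    c.1.2 < 2 ^ M /\ c.2.2 < 2 ^ M.
  by rewrite flatten_cat mem_cat => /orP[] H; [apply: (side par false)|apply: (side par true)];
    rewrite /side_net map_flatten.
have sweep : c \in flatten (sweep_rounds d f M) -> c.1.2 < 2 ^ M /\ c.2.2 < 2 ^ M.
  by rewrite flatten_cat mem_cat => /orP[]; apply: sides.
rewrite /split_rounds (flatten_cat (center_rounds d f M)) mem_cat => /orP[|]; first exact: center.
case/flattenP => R /flattenP[S /mapP[h hM ->] RR] cR.
rewrite mem_rev mem_iota in hM.
have : c \in flatten (stage_rounds d f M h) by apply/flattenP; exists R.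
rewrite /stage_rounds 2!(flatten_cat (sweep_rounds d f M)).
rewrite !(mem_cat _ (flatten (sweep_rounds d f M))) => /or3P[||]; try exact: sweep.
by apply: center; lia.
Qed.

Section Inputs.

Variables (r : nat) (ws : seq 'I_n).

(** The low paddings together with the [r] smallest elements number exactly [2 ^ M], so the cut at
    rank [r] falls between the two halves. *)
Definition split_items : seq (item n) :=
  nseq (2 ^ M - r) (inr false) ++ map inl ws ++ nseq (2 ^ M - (size ws - r)) (inr true).

Definition split_init (x : pos) : item n :=
  if x.2 < 2 ^ M then nth (inr false) split_items (x.1 * 2 ^ M + x.2) else inr x.1.

Definition element (u : item n) : option 'I_n := if u is inl i then Some i else None.

Definition side_elements (s : pos -> item n) b :=
  pmap element [seq s (b, p) | p <- iota 0 (2 ^ M)].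

Definition splitter : ctree n (seq 'I_n * seq 'I_n) :=
  bind (netc (flatten (split_rounds d f M)) split_init)
       (fun s => Ret (side_elements s false, side_elements s true)).

Hypothesis ws_uniq : uniq ws.
Hypothesis r_ws : r <= size ws.
Hypothesis ws_M : size ws <= 2 ^ M.

Lemma size_split_items : size split_items = 2 ^ M + 2 ^ M.
Proof. by rewrite !size_cat !size_nseq size_map; lia. Qed.

Lemma map_split_init : map split_init positions = split_items.
Proof.
rewrite map_cat -!map_comp.
have -> : map (split_init \o pair false) (iota 0 (2 ^ M)) = take (2 ^ M) split_items.
  rewrite -[in RHS](drop0 split_items) -(map_nth_iota (inr false)); last first.
    by rewrite subn0 size_split_items leq_addr.
  by apply/eq_in_map => p; rewrite mem_iota /= /split_init /= => ->; rewrite mul0n.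
have -> : map (split_init \o pair true) (iota 0 (2 ^ M)) = drop (2 ^ M) split_items.
  rewrite -[RHS](@take_size _) size_drop size_split_items addnK.
  rewrite -(map_nth_iota (inr false)) ?size_split_items ?addnK //.
  have -> : iota (2 ^ M) (2 ^ M) = map (addn (2 ^ M)) (iota 0 (2 ^ M)) by rewrite -iotaDl addn0.
  rewrite -map_comp.
  by apply/eq_in_map => p; rewrite mem_iota /= /split_init /= => ->; rewrite mul1n.
exact: cat_take_drop.
Qed.

Lemma split_initP x e : split_init x = inl e ->
  [/\ x.2 < 2 ^ M, x.1 * 2 ^ M + x.2 = 2 ^ M - r + index e ws & e \in ws].
Proof.
rewrite /split_init; case: ifP => // x2; rewrite nth_cat size_nseq nth_nseq.
case: ltnP => // H; rewrite nth_cat size_map; case: ltnP => H'; last first.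
  by rewrite nth_nseq; case: ifP.
rewrite (nth_map e) // => -[E]; split=> //; last by rewrite -E mem_nth.
by rewrite -E index_uniq // subnKC.
Qed.

Lemma once_split_init e : once split_init e.
Proof.
move=> [s p] [s' p'] /split_initP[/= pM E _] /split_initP[/= pM' E' _].
by case: s E E'; case: s' => /= E E'; congr (_, _); lia.
Qed.

Lemma pmap_split_items : pmap element split_items = ws.
Proof.
have pad k b : pmap element (nseq k (inr b)) = [::] by elim: k.
rewrite !pmap_cat !pad cats0 /=.
by elim: (ws) => //= i s ->.
Qed.

Variable a : 'I_n -> nat.

Lemma cost_splitter e : 0 < M -> cost a splitter e <= 18 * d * M * (e \in ws).
Proof.
move=> M0; rewrite cost_bind /= addn0; case: (boolP (e \in ws)) => ew.
  rewrite muln1; apply: leq_trans (size_split_rounds d f M0).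
  by apply: cost_netc_rounds => [R|]; [apply: (split_rounds_uniq fP)|apply: once_split_init].
by rewrite cost_netc_away // => p _ /split_initP[_ _ ew']; rewrite ew' in ew.
Qed.

(** The 0-1 principle at the threshold [r <= rank a ws i]: there are as many ones as right
    positions, so the marking is admissible and the network leaves no position bad. *)
Lemma splitterP (LR := result a splitter) : injective a -> 0 < M ->
  [/\ perm_eq (LR.1 ++ LR.2) ws, size LR.1 = r &
      forall x y, x \in LR.1 -> y \in LR.2 -> a x < a y].
Proof.
move=> inj_a M0.
pose one (u : item n) := match u with inl i => r <= rank a ws i | inr b => b end.
rewrite /LR /splitter result_bind result_netc /=; set s := run_net _ _ _.
have hom : one \o s =1 push (flatten (split_rounds d f M)) (one \o split_init).
  apply: run_net_hom => [[i|[]] [j|[]]|[i|[]] [j|[]]] //=.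
    by rewrite -leqNgt => ji rj; apply: leq_trans rj _; apply: leq_rank.
  by rewrite negbK => ij ri; apply: leq_trans ri _; apply/leq_rank/ltnW.
have perm : perm_eq (map s positions) split_items.
  rewrite -map_split_init; apply: perm_run_net; first exact: positions_uniq.
  by move=> c /mem_split_net[c1 c2]; rewrite !mem_positions c1 c2.
have cnt : count one split_items = 2 ^ M.
  rewrite !count_cat !count_nseq count_map /= mul0n add0n mul1n.
  have -> : count (preim inl one) ws = size ws - r.
    rewrite -[in RHS](count_rank_lt inj_a ws_uniq r_ws).
    rewrite -(count_predC (fun i => rank a ws i < r) ws) addKn.
    by apply: eq_count => i; rewrite /= -leqNgt.
  by lia.
have adm : admissible M (one \o split_init).
  split=> [b p Mp|]; first by rewrite /bad /= /split_init /= ltnNge Mp /= addbb.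
  pose ones b := count (preim (split_init \o pair b) one) (iota 0 (2 ^ M)).
  have ct : ones true + core_count (bad true (one \o split_init)) M = 2 ^ M.
    exact: core_count_true.
  have cf : ones false = core_count (bad false (one \o split_init)) M.
    by apply: eq_count => p; rewrite /bad addbF.
  have : ones false + ones true = 2 ^ M.
    by rewrite -[RHS]cnt -map_split_init map_cat count_cat -!map_comp !count_map.
  by rewrite -cf; lia.
have correct b p := split_rounds_correct fP b p M0 adm.
have final b x : x \in side_elements s b -> one (inl x) = b.
  rewrite mem_pmap => /mapP[u /mapP[p _ ->]]; case E: (s (b, p)) => [i|] //= [->].
  have := correct b p; rewrite /bad -hom /= E /=.
  by case: (b); rewrite ?addbT ?addbF ?negbK // => /negPf.
have perm_ws : perm_eq (side_elements s false ++ side_elements s true) ws.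
  by rewrite /side_elements -pmap_cat -[X in perm_eq _ X]pmap_split_items; apply: perm_pmap;
     apply: perm_trans perm; rewrite /positions map_cat -!map_comp.
split=> //= [|x y /final xL /final yR].
  have /permP/(_ (fun i => rank a ws i < r)) := perm_ws.
  rewrite count_rank_lt // count_cat.
  rewrite (@eq_in_count _ _ xpredT) => [|x /final /=]; last by rewrite ltnNge => ->.
  rewrite count_predT (@eq_in_count _ _ pred0) => [|x /final /=]; last by rewrite ltnNge => ->.
  by rewrite count_pred0 addn0.
rewrite ltnNge; apply/negP => /(leq_rank ws) yx.
by move: xL; rewrite /= (leq_trans yR yx).
Qed.

End Inputs.
End Split.

(** * Adaptive search for the median *)

Lemma sum_eq1_leq (k : nat) s : uniq s -> \sum_(j <- s) (k == j) <= 1.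
Proof.
move=> u; rewrite -big_mkcond /= sum1_count (eq_count (a2 := pred1 k)) => [|j].
  by rewrite count_uniq_mem // leq_b1.
by rewrite /= eq_sym.
Qed.

Lemma size_ord_seq_leq n (ws : seq 'I_n) lo k : uniq ws ->
  (forall x, x \in ws -> lo <= x < lo + k) -> size ws <= k.
Proof.
move=> u H; rewrite -(size_map val) -[leqRHS](size_iota lo) uniq_leq_size //.
  by rewrite map_inj_uniq //; apply: val_inj.
by move=> _ /mapP[x xw ->]; rewrite mem_iota H.
Qed.

Lemma count_ord_lt m k : k <= m -> count (fun y : 'I_m => y < k) (enum 'I_m) = k.
Proof.
move=> km; rewrite -[LHS](count_map val (fun y => y < k)) val_enum_ord.
rewrite -(subnKC km) iotaD count_cat add0n.
rewrite (@eq_in_count _ _ xpredT) => [|y]; last by rewrite mem_iota => /andP[_ ->].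
rewrite count_predT size_iota (@eq_in_count _ _ pred0) ?count_pred0 ?addn0 // => y.
by rewrite mem_iota => /andP[ky _]; rewrite ltnNge ky.
Qed.

(** Each position [t] in $(p, q]$ yields its own inversion: [(p, t)] if [a t < a p], and otherwise
    [(t, q)]. *)
Lemma inv_lower_bound n (a : 'I_n -> nat) (p q : 'I_n) :
  p < q -> a q < a p -> q - p <= inv a.
Proof.
case: n a p q => [|n] a p q pq qp; first by case: p pq qp.
pose t (k : 'I_(q - p)) : 'I_n.+1 := inord (p + k.+1).
have tE k : t k = p + k.+1 :> nat by rewrite inordK //; have := ltn_ord k; have := ltn_ord q; lia.
pose g k := if a (t k) < a p then (p, t k) else (t k, q).
have t_inj k k' : t k = t k' -> k = k'.
  by move=> /(congr1 val); rewrite /= !tE => E; apply: val_inj => /=; lia.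
have pt k : p <> t k by move=> /(congr1 val); rewrite /= tE; lia.
have g_inj : injective g.
  move=> k k'; rewrite /g; case: ifP => _; case: ifP => _ [].
  - exact: t_inj.
  - by move=> E; case: (pt k').
  - by move=> E; case: (pt k).
  - exact: t_inj.
rewrite -[q - p]card_ord -(card_imset _ g_inj).
apply/subset_leq_card/subsetP => _ /imsetP[k _ ->].
rewrite inE /g; case: ifP => [tp|/negbT tp] /=; first by rewrite tE tp; lia.
have tq : t k != q by apply: contraNneq tp => ->.
have : (t k : nat) != q by [].
by have := ltn_ord k; rewrite tE; move: tp; rewrite -leqNgt; lia.
Qed.

Section Median.

Variables (d : nat) (f : nat -> nat -> nat -> nat).
Hypothesis fP : forall b, expander 256 128 d b (f b).
Variable n : nat.
Local Notation elt := 'I_n.+1.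

(* The first split isolates the [r.+1] smallest elements, the second one the largest of these. *)
Definition select M r (ws : seq elt) : ctree n.+1 elt :=
  bind (splitter d f M r.+1 ws) (fun LR =>
    bind (splitter d f M r LR.1) (fun LR' => Ret (head ord0 LR'.2))).

Definition block B j : seq elt := [seq x : elt <- enum 'I_n.+1 | x %/ B == j].

Definition extrema M B j : ctree n.+1 (elt * elt) :=
  bind (select M 0 (block B j)) (fun mn =>
    bind (select M (size (block B j)).-1 (block B j)) (fun mx => Ret (mn, mx))).

Fixpoint all_lt (ps : seq (elt * elt)) : ctree n.+1 bool :=
  if ps is p :: ps' then Cmp p.1 p.2 (all_lt ps') (Ret false) else Ret true.

Definition gap_tests (es : seq (elt * elt)) g : seq (elt * elt) :=
  let e0 := (ord0, ord0) in
  [seq ((nth e0 es j).2, (nth e0 es (j + g)).1) | j <- iota 0 (size es - g)].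

(* Gaps 2 and 3 generate all gaps that are at least 2. *)
Definition verify M B : ctree n.+1 bool :=
  bind (mapc (extrema M B) (iota 0 (n %/ B).+1))
       (fun es => all_lt (gap_tests es 2 ++ gap_tests es 3)).

Definition window B : seq elt :=
  [seq x : elt <- enum 'I_n.+1 | (n./2 %/ B <= (x %/ B).+1) && (x %/ B <= (n./2 %/ B).+1)].

Definition window_rank B :=
  n./2 - count (fun x : elt => (x %/ B).+1 < n./2 %/ B) (enum 'I_n.+1).

(* The fuel [n - i] cannot run out before the block length exceeds [n]. *)
Fixpoint phase fuel i : ctree n.+1 elt :=
  if fuel is fuel'.+1 then
    let B := 2 ^ 2 ^ i in
    bind (verify (2 ^ i) B) (fun ok =>
      if ok then select (2 ^ i + 2) (window_rank B) (window B) else phase fuel' i.+1)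
  else select (2 ^ i) n./2 (enum 'I_n.+1).

Variable a : elt -> nat.
Hypothesis inj_a : injective a.

Lemma selectP M r ws (z := result a (select M r ws)) :
  0 < M -> uniq ws -> r < size ws -> size ws <= 2 ^ M ->
  (z \in ws) && (rank a ws z == r).
Proof.
move=> M0 u rw wM; rewrite /z /select.
rewrite (result_bind a (splitter d f M r.+1 ws)) (result_bind a (splitter d f M r _)).
have [] := splitterP fP u rw wM inj_a M0; set LR := result a _ => perm sizeL lt.
have uLR : uniq (LR.1 ++ LR.2) by rewrite (perm_uniq perm).
have uL : uniq LR.1 by move: uLR; rewrite cat_uniq => /and3P[].
have [||] := splitterP fP uL _ _ inj_a M0 (r := r); first by rewrite sizeL.
  by rewrite sizeL (leq_trans rw wM).
set LR' := result a _ => perm' sizeL' lt'.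
have : size LR'.2 = 1.
  by apply: (@addnI r); rewrite addn1 -sizeL -(perm_size perm') size_cat sizeL'.
case ER : LR'.2 => [|x [|? ?]] //= _.
have xL : x \in LR.1 by rewrite -(perm_mem perm') mem_cat ER mem_head orbT.
rewrite -(perm_mem perm) mem_cat xL /=.
rewrite /rank -(permP perm) count_cat -(permP perm') count_cat ER /= ltnn !addn0.
rewrite (@eq_in_count _ _ xpredT) => [|y yL]; last by rewrite lt' ?ER ?mem_head.
rewrite count_predT sizeL' (@eq_in_count _ _ pred0) ?count_pred0 ?addn0 // => y yR.
by apply/negbTE; rewrite -leqNgt ltnW // lt.
Qed.

Lemma cost_select M r ws e : 0 < M -> uniq ws -> r < size ws -> size ws <= 2 ^ M ->
  cost a (select M r ws) e <= 36 * d * M * (e \in ws).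
Proof.
move=> M0 u rw wM; rewrite /select.
rewrite (cost_bind a (splitter d f M r.+1 ws)) (cost_bind a (splitter d f M r _)) addn0.
have [] := splitterP fP u rw wM inj_a M0; set LR := result a _ => perm sizeL lt.
have uL : uniq LR.1.
  by move: u; rewrite -(perm_uniq perm) cat_uniq => /and3P[].
have c1 := cost_splitter fP u rw wM a e M0.
have c2 : cost a (splitter d f M r LR.1) e <= 18 * d * M * (e \in LR.1).
  by apply: cost_splitter => //; rewrite sizeL // (leq_trans rw).
have sub : (e \in LR.1) <= (e \in ws).
  by rewrite -(perm_mem perm) mem_cat; case: (e \in LR.1).
apply: leq_trans (leq_add c1 c2) _.
by move: sub; case: (e \in LR.1); case: (e \in ws) => /=; lia.
Qed.

Lemma mem_block B j x : (x \in block B j) = (x %/ B == j).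
Proof. by rewrite mem_filter mem_enum andbT. Qed.

Lemma block_uniq B j : uniq (block B j).
Proof. by rewrite filter_uniq ?enum_uniq. Qed.

Lemma size_block B j : 0 < B -> size (block B j) <= B.
Proof.
move=> B0; apply: (size_ord_seq_leq (lo := j * B)) (block_uniq B j) _ => x.
by rewrite mem_block => /eqP <-; rewrite leq_trunc_div -mulSnr ltn_ceil.
Qed.

Lemma size_block_gt0 B j : 0 < B -> j <= n %/ B -> 0 < size (block B j).
Proof.
move=> B0 jn; have jB : j * B < n.+1 by rewrite ltnS -leq_divRL.
by rewrite -has_predT; apply/hasP; exists (Ordinal jB); rewrite // mem_block /= mulnK.
Qed.

Lemma result_all_lt ps : result a (all_lt ps) = all (fun p => a p.1 < a p.2) ps.
Proof. by elim: ps => //= p ps ->; case: ifP. Qed.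

Lemma cost_all_lt ps e : cost a (all_lt ps) e <= \sum_(p <- ps) ((p.1 == e) || (p.2 == e)).
Proof.
elim: ps => [|p ps IH] /=; first by rewrite big_nil.
by rewrite big_cons leq_add2l; case: ifP.
Qed.

Section Phase.

Variables (M : nat).
Hypothesis M0 : 0 < M.
Let B := 2 ^ M.

Let B0 : 0 < B. Proof. by rewrite expn_gt0. Qed.

Definition extremum j := result a (extrema M B j).

Lemma extremumP j : j <= n %/ B ->
  [/\ (extremum j).1 \in block B j, (extremum j).2 \in block B j &
      forall x, x \in block B j -> a (extremum j).1 <= a x <= a (extremum j).2].
Proof.
move=> jn; rewrite /extremum /extrema.
rewrite (result_bind a (select _ _ _)) (result_bind a (select _ _ _)) /=.
have s0 := size_block_gt0 B0 jn; have u := block_uniq B j.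
have sM : size (block B j) <= 2 ^ M := size_block j B0.
have /andP[mn_in /eqP mn_rank] := selectP M0 u s0 sM.
have s1 : (size (block B j)).-1 < size (block B j) by rewrite prednK.
have /andP[mx_in /eqP mx_rank] := selectP M0 u s1 sM.
split=> // x xB; apply/andP; split; rewrite leqNgt; apply/negP => /ltn_rank.
  by move=> /(_ _ xB); rewrite mn_rank.
by move=> /(_ _ mx_in); rewrite mx_rank prednK // leqNgt rank_lt_size.
Qed.

Lemma cost_extrema j e : j <= n %/ B ->
  cost a (extrema M B j) e <= 72 * d * M * (e %/ B == j).
Proof.
move=> jn; rewrite /extrema (cost_bind a (select _ _ _)) (cost_bind a (select _ _ _)) addn0.
have s0 := size_block_gt0 B0 jn; have u := block_uniq B j.
have sM : size (block B j) <= 2 ^ M := size_block j B0.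
have s1 : (size (block B j)).-1 < size (block B j) by rewrite prednK.
have := cost_select e M0 u s0 sM; have := cost_select e M0 u s1 sM; rewrite mem_block.
by case: (_ == j); lia.
Qed.

Lemma result_verify : result a (verify M B) = all (fun p => a p.1 < a p.2)
  (let es := [seq extremum j | j <- iota 0 (n %/ B).+1] in gap_tests es 2 ++ gap_tests es 3).
Proof. by rewrite /verify result_bind result_mapc result_all_lt. Qed.

Lemma gap_testsE g : gap_tests [seq extremum j | j <- iota 0 (n %/ B).+1] g =
  [seq ((extremum j).2, (extremum (j + g)).1) | j <- iota 0 ((n %/ B).+1 - g)].
Proof.
rewrite /gap_tests size_map size_iota; apply/eq_in_map => j; rewrite mem_iota => /andP[_ jn].
by rewrite !(nth_map 0) ?size_iota ?nth_iota //; lia.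
Qed.

Lemma verify_sound : result a (verify M B) ->
  forall x y : elt, (x %/ B).+2 <= y %/ B -> a x < a y.
Proof.
rewrite result_verify /= all_cat !gap_testsE => /andP[/allP H2 /allP H3].
have yn (y : elt) : y %/ B <= n %/ B by apply: leq_div2r; rewrite -ltnS.
have direct g (x y : elt) : g \in [:: 2; 3] -> y %/ B = x %/ B + g -> a x < a y.
  move=> g23 yx; have := yn y; rewrite yx => xn.
  have [_ mx_in /(_ x)] := extremumP (leq_trans (leq_addr g _) xn).
  have [mn_in _ /(_ y)] := extremumP xn.
  rewrite !mem_block yx !eqxx => /(_ isT)/andP[lo _] /(_ isT)/andP[_ hi].
  apply: leq_ltn_trans hi (leq_trans _ lo).
  have jin : x %/ B \in iota 0 ((n %/ B).+1 - g) by rewrite mem_iota add0n ltn_subRL ltnS addnC.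
  move: g23; rewrite !inE => /orP[] /eqP E; subst g.
    exact: (H2 _ (map_f (fun j => ((extremum j).2, (extremum (j + 2)).1)) jin)).
  exact: (H3 _ (map_f (fun j => ((extremum j).2, (extremum (j + 3)).1)) jin)).
suff gap k (x y : elt) : y %/ B = x %/ B + k.+2 -> a x < a y.
  by move=> x y xy; apply: (gap (y %/ B - (x %/ B).+2)); lia.
elim/ltn_ind: k x y => -[|[|k]] IH x y yx; try exact: (direct _ _ _ _ yx).
(* A gap of at least 4 is crossed through the first element of the block two to the right of that of
   [x]. *)
have zn : (x %/ B + 2) * B < n.+1.
  by rewrite ltnS -leq_divRL //; apply: leq_trans (yn y); rewrite yx leq_add2l.
have zB : Ordinal zn %/ B = x %/ B + 2 by rewrite /= mulnK.
apply: (@ltn_trans (a (Ordinal zn))); first exact: direct zB.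
by apply: (IH k); rewrite // zB yx -addnA.
Qed.

(** A failed test exhibits an inversion between blocks at distance at least 2, hence between
    positions more than [B] apart. *)
Lemma verify_complete : ~~ result a (verify M B) -> B <= inv a.
Proof.
rewrite result_verify /= all_cat negb_and !gap_testsE.
have fail g : 1 < g -> ~~ all (fun p : elt * elt => a p.1 < a p.2)
    [seq ((extremum j).2, (extremum (j + g)).1) | j <- iota 0 ((n %/ B).+1 - g)] -> B <= inv a.
  move=> g1 /allPn[c /mapP[j]]; rewrite mem_iota => jn -> /= Hlt.
  have [jn1 jn2] : j <= n %/ B /\ j + g <= n %/ B by move: (n %/ B) jn => ?; lia.
  have [_ + _] := extremumP jn1; have [+ _ _] := extremumP jn2; rewrite !mem_block.
  move: Hlt; move: (extremum j).2 (extremum (j + g)).1 => p q Hlt /eqP qj /eqP pj.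
  have pq : p + B < q.
    have := leq_trunc_div q B; have := ltn_ceil p B0; rewrite qj pj mulSn mulnDl.
    by have : 2 * B <= g * B by [rewrite leq_mul2r g1 orbT]; lia.
  apply: leq_trans (inv_lower_bound (p := p) (q := q) _ _); try lia.
  rewrite ltn_neqAle leqNgt Hlt andbT; apply/eqP => /inj_a E.
  by rewrite E in pq; lia.
by case/orP; apply: fail.
Qed.

(** An element lies in one block only. For each of the two gaps it is tested at most once as a
    maximum and once as a minimum, whence the 4. *)
Lemma cost_verify e : cost a (verify M B) e <= 72 * d * M + 4.
Proof.
rewrite /verify cost_bind cost_mapc result_mapc; apply: leq_add.
  apply: (@leq_trans (\sum_(j <- iota 0 (n %/ B).+1) 72 * d * M * (e %/ B == j))).
    rewrite !big_seq; apply: leq_sum => j; rewrite mem_iota => /andP[_ jn].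
    exact: cost_extrema.
  have := leq_mul (leqnn (72 * d * M)) (sum_eq1_leq (e %/ B) (iota_uniq 0 (n %/ B).+1)).
  by rewrite muln1 big_distrr.
apply: leq_trans (cost_all_lt _ _) _.
rewrite -/extremum big_cat !gap_testsE /= -[4]/(2 + 2).
have tests g : \sum_(p <- [seq ((extremum j).2, (extremum (j + g)).1)
    | j <- iota 0 ((n %/ B).+1 - g)])
    ((p.1 == e) || (p.2 == e)) <= 2.
  rewrite big_map /=.
  apply: (@leq_trans (\sum_(j <- iota 0 ((n %/ B).+1 - g))
    ((e %/ B == j) + (e %/ B == j + g)))).
    rewrite !big_seq; apply: leq_sum => j; rewrite mem_iota => jn.
    have [jn1 jn2] : j <= n %/ B /\ j + g <= n %/ B by move: (n %/ B) jn => ?; lia.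
    have [_ + _] := extremumP jn1; have [+ _ _] := extremumP jn2; rewrite !mem_block.
    move=> /eqP E2 /eqP E1.
    case: eqP => [<-|_]; first by rewrite E1 eqxx; case: (_ || _).
    by case: eqP => [<-|_] //; rewrite E2 eqxx addn1.
  rewrite big_split /= (leq_add (n1 := 1) (n2 := 1)) //; first by rewrite sum_eq1_leq ?iota_uniq.
  rewrite -(big_map (addn^~ g) xpredT (fun j => (e %/ B == j : nat))) sum_eq1_leq //.
  by rewrite map_inj_uniq ?iota_uniq // => j j' /addIn.
by rewrite leq_add.
Qed.

End Phase.

End Median.

Lemma sub_count_lt (T : eqType) (P Q : pred T) s z :
  subpred P Q -> z \in s -> Q z -> ~~ P z -> count P s < count Q s.
Proof.
move=> PQ; elim: s => //= y s IH; rewrite inE => /predU1P[<-|/IH H] Qz Pz.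
  by rewrite Qz (negPf Pz) add0n add1n ltnS sub_count.
rewrite -addnS leq_add ?H //; case: (boolP (P y)) => // /PQ.
by move=> ->.
Qed.

Section Median.

Variables (d : nat) (f : nat -> nat -> nat -> nat).
Hypothesis fP : forall b, expander 256 128 d b (f b).
Variable n : nat.
Local Notation elt := 'I_n.+1.
Variable a : elt -> nat.
Hypothesis inj_a : injective a.

Lemma is_median_rank z : is_median a z = (rank a (enum 'I_n.+1) z == n./2).
Proof.
rewrite /is_median /rank cardE enumT -size_filter /enum_mem; congr (size _ == _).
by apply: eq_filter => y; rewrite !inE.
Qed.

(** * The median inside the three middle blocks *)

Section Window.

Variable B : nat.
Hypothesis B0 : 0 < B.
Let mid := n./2 %/ B.
Let all_elts := enum 'I_n.+1.

Hypothesis sorted_blocks : forall x y : elt, (x %/ B).+2 <= y %/ B -> a x < a y.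

Let left (x : elt) := (x %/ B).+1 < mid.
Let inside (x : elt) := (mid <= (x %/ B).+1) && (x %/ B <= mid.+1).

Lemma count_below k : k * B <= n.+1 -> count (fun x : elt => x %/ B < k) all_elts = k * B.
Proof.
move=> kn; rewrite -[RHS](count_ord_lt kn); apply: eq_count => x.
by rewrite ltn_divLR.
Qed.

Lemma count_half : count (fun x : elt => x < n./2.+1) all_elts = n./2.+1.
Proof. by apply: count_ord_lt; rewrite ltnS -divn2 leq_div. Qed.

Lemma count_left_window : n./2 < count left all_elts + count inside all_elts.
Proof.
rewrite -[n./2.+1]count_half -count_predUI; apply: leq_trans (leq_addr _ _).
apply: sub_count => x; rewrite /left /inside /= ltnS => /(leq_div2r B).
by rewrite -/mid => xm; rewrite (leq_trans xm) // andbT orbC leqNgt orNb.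
Qed.

Lemma count_left : count left all_elts <= n./2.
Proof.
have le : mid * B <= n./2 by apply: leq_trunc_div.
rewrite (leq_trans _ le) // -count_below.
  by apply: sub_count => x; apply: ltnW.
by rewrite (leq_trans le) // -divn2 (leq_trans (leq_div _ _)).
Qed.

Lemma window_rank_lt : window_rank n B < size (window n B).
Proof.
rewrite /window_rank size_filter.
by have := count_left_window; have := count_left; rewrite /left /inside /mid /all_elts; lia.
Qed.

Lemma rank_window z : rank a (window n B) z = count (fun x => inside x && (a x < a z)) all_elts.
Proof. by rewrite /rank count_filter; apply: eq_count => x; rewrite /= andbC. Qed.

(** Otherwise [z] lies in a block before [mid] and is smaller than everything from block [mid] on.
    Then [z], the left elements and the window elements below [z] all fit into [mid * B <= n./2]
    positions, while the latter two kinds alone number [n./2]. *)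
Lemma left_below z : inside z -> rank a (window n B) z = window_rank n B ->
  forall x, left x -> a x < a z.
Proof.
move=> zin zr x xl; rewrite ltnNge; apply/negP => zx.
have zl : z %/ B < mid.
  rewrite ltnNge; apply/negP => zm; have : a x < a z by apply: sorted_blocks; apply: leq_trans zm.
  by rewrite ltnNge zx.
have big (y : elt) : mid <= y %/ B -> a z < a y.
  by move=> ym; apply: leq_ltn_trans zx (sorted_blocks _); apply: leq_trans ym.
have le : mid * B <= n./2 by apply: leq_trunc_div.
have : count left all_elts + rank a (window n B) z < mid * B.
  rewrite -count_below; last by rewrite (leq_trans le) // -divn2 (leq_trans (leq_div _ _)).
  rewrite rank_window -count_predUI (@eq_in_count _ (predI _ _) pred0); last first.
    by move=> y _; rewrite /= /left /inside; case: leqP.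
  rewrite count_pred0 addn0; apply: (sub_count_lt (z := z)) => //; first last.
  - by rewrite /= ltnn andbF orbF /left -leqNgt; case/andP: zin.
  - by rewrite mem_enum.
  move=> y /= /orP[/ltnW //|/andP[_ yz]]; rewrite ltnNge; apply/negP => /big.
  by rewrite ltnNge ltnW.
by rewrite zr /window_rank subnKC ?count_left // ltnNge le.
Qed.

(** Otherwise everything up to block [mid] is below [z], in particular the [n./2.+1] first
    positions, which is one element too many. *)
Lemma right_above z : inside z -> rank a (window n B) z = window_rank n B ->
  forall x : elt, mid.+1 < x %/ B -> a z < a x.
Proof.
move=> zin zr x xr; rewrite ltnNge; apply/negP => xz.
have small (y : elt) : y %/ B <= mid -> a y < a z.
  by move=> ym; apply: leq_trans xz; apply: sorted_blocks; apply: leq_trans xr.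
have : n./2 < count left all_elts + rank a (window n B) z.
  rewrite rank_window -count_predUI -[n./2.+1]count_half; apply: leq_trans (leq_addr _ _).
  apply: sub_count => y; rewrite /= ltnS => /(leq_div2r B); rewrite -/mid => ym.
  by rewrite small // andbT /left /inside (leq_trans ym) // andbT orbC leqNgt orNb.
by rewrite zr /window_rank subnKC ?count_left // ltnn.
Qed.

Lemma window_median z : z \in window n B -> rank a (window n B) z = window_rank n B ->
  is_median a z.
Proof.
rewrite mem_filter => /andP[zin _] zr; rewrite is_median_rank.
have lb := left_below zin zr; have ra := right_above zin zr.
have -> : rank a (enum 'I_n.+1) z = count left all_elts + rank a (window n B) z.
  rewrite rank_window -count_predUI (@eq_in_count _ (predI _ _) pred0); last first.
    by move=> y _; rewrite /= /left /inside; case: leqP.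
  rewrite count_pred0 addn0; apply: eq_count => y /=.
  case: (boolP (left y)) => [/lb -> //|yl] /=.
  case: (boolP (inside y)) => //= yi; apply/negbTE; rewrite -leqNgt ltnW // ra //.
  by move: yl yi; rewrite /left /inside -leqNgt => -> /=; rewrite -ltnNge.
by rewrite zr /window_rank subnKC ?count_left.
Qed.

Lemma size_window : size (window n B) <= 3 * B.
Proof.
apply: (size_ord_seq_leq (lo := mid.-1 * B)); first by rewrite filter_uniq ?enum_uniq.
move=> x; rewrite mem_filter -/mid => /andP[/andP[xl xr] _].
have := leq_trunc_div x B; have := ltn_ceil x B0.
move: (nat_of_ord x) xl xr => {}x; move: (x %/ B) (mid) => k m xl xr.
have : m.-1 * B <= k * B by rewrite leq_mul2r; apply/orP; right; lia.
have : k.+1 * B <= (m.-1 + 3) * B by rewrite leq_mul2r; apply/orP; right; lia.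
by rewrite mulnDl; move: (k * B) (k.+1 * B) (m.-1 * B) (3 * B) => *; lia.
Qed.

End Window.

Lemma select_window i (z := result a (select d f (2 ^ i + 2)
    (window_rank n (2 ^ 2 ^ i)) (window n (2 ^ 2 ^ i)))) :
  result a (verify d f n (2 ^ i) (2 ^ 2 ^ i)) -> is_median a z.
Proof.
move=> ok; have B0 : 0 < 2 ^ 2 ^ i by rewrite expn_gt0.
have M0 : 0 < 2 ^ i by rewrite expn_gt0.
have sorted := verify_sound fP inj_a M0 ok.
have /andP[zw /eqP zr] : (z \in window n (2 ^ 2 ^ i)) &&
    (rank a (window n (2 ^ 2 ^ i)) z == window_rank n (2 ^ 2 ^ i)).
  apply: selectP => //; first by rewrite addn2.
  - by rewrite filter_uniq ?enum_uniq.
  - exact: window_rank_lt.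
  - by rewrite (leq_trans (size_window B0)) // expnD mulnC leq_mul2l orbT.
exact: window_median zw zr.
Qed.

Lemma fuel_bound i : n <= 0 + i -> n.+1 <= 2 ^ 2 ^ i.
Proof.
move=> ni; apply: leq_trans (ltnW (ltn_expl (2 ^ i) (isT : 1 < 2))).
by apply: leq_ltn_trans ni (ltn_expl _ _).
Qed.

Lemma phase_median fuel i : n <= fuel + i -> is_median a (result a (phase d f n fuel i)).
Proof.
elim: fuel i => [|fuel IH] i ni.
  have M0 : 0 < 2 ^ i by rewrite expn_gt0.
  rewrite is_median_rank.
  have /andP[] // : let z := result a (phase d f n 0 i) in
    (z \in enum 'I_n.+1) && (rank a (enum 'I_n.+1) z == n./2).
  apply: selectP => //; rewrite ?enum_uniq ?size_enum_ord //.
    by rewrite ltnS -divn2 leq_div.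
  exact: fuel_bound.
rewrite /=; rewrite result_bind; case: ifP => [ok|_]; first exact: select_window.
by apply: IH; rewrite addnS.
Qed.

Lemma cost_select_window i e : cost a (select d f (2 ^ i + 2)
    (window_rank n (2 ^ 2 ^ i)) (window n (2 ^ 2 ^ i))) e <= 108 * d * 2 ^ i.
Proof.
have B0 : 0 < 2 ^ 2 ^ i by rewrite expn_gt0.
have := cost_select fP inj_a e (M := 2 ^ i + 2)
  (r := window_rank n (2 ^ 2 ^ i)) (ws := window n (2 ^ 2 ^ i)).
rewrite addn2 filter_uniq ?enum_uniq // window_rank_lt // => /(_ isT isT isT) H.
apply: leq_trans (H _) _.
  by rewrite (leq_trans (size_window B0)) // -[(2 ^ i).+2]addn2 expnD mulnC leq_mul2l orbT.
have : 0 < 2 ^ i by rewrite expn_gt0.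
by case: (e \in _) => /=; move: (2 ^ i) => k; nia.
Qed.

(** The term with [2 ^ i] is a potential: a phase costs at most [(180 * d + 4) * 2 ^ i], exactly the
    growth of the potential from [i] to [i.+1]. A failed check restores the bound on [2 ^ i] for the
    next phase. *)
Lemma cost_phase fuel i e : n <= fuel + i -> 2 ^ i <= 2 * lg (inv a) ->
  cost a (phase d f n fuel i) e + (180 * d + 4) * 2 ^ i <= (180 * d + 4) * (4 * lg (inv a)).
Proof.
elim: fuel i => [|fuel IH] i ni ilg.
  have M0 : 0 < 2 ^ i by rewrite expn_gt0.
  have : cost a (phase d f n 0 i) e <= 36 * d * 2 ^ i * (e \in enum 'I_n.+1).
    apply: cost_select => //; rewrite ?enum_uniq ?size_enum_ord ?fuel_bound //.
    by rewrite ltnS -divn2 leq_div.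
  have : 2 * ((180 * d + 4) * 2 ^ i) <= (180 * d + 4) * (4 * lg (inv a)).
    by rewrite mulnCA leq_mul2l; apply/orP; right; lia.
  by rewrite mem_enum muln1; move: (2 ^ i) M0 => k; nia.
rewrite /= cost_bind.
have cv : cost a (verify d f n (2 ^ i) (2 ^ 2 ^ i)) e <= 72 * d * 2 ^ i + 4.
  by apply: cost_verify; rewrite ?expn_gt0.
have cw := cost_select_window i e.
have P0 : 0 < 2 ^ i by rewrite expn_gt0.
case: ifP => [_|/negbT fail].
  have : 2 * ((180 * d + 4) * 2 ^ i) <= (180 * d + 4) * (4 * lg (inv a)).
    by rewrite mulnCA leq_mul2l; apply/orP; right; lia.
  by move: cv cw P0; move: (2 ^ i) => k; nia.
have le : 2 ^ i <= lg (inv a).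
  rewrite /lg trunc_log_max // (leq_trans _ (leq_maxl _ _)) //.
  by apply: verify_complete fail; rewrite ?expn_gt0.
have := IH i.+1; rewrite addnS expnS leq_mul2l /= => /(_ ni le).
by move: cv P0; move: (2 ^ i) (cost _ _ _) (cost _ _ _) => k x y; nia.
Qed.

End Median.

(** * The adversary *)

Lemma card_ord_lt m k : k <= m -> #|[set x : 'I_m | x < k]| = k.
Proof.
move=> km; rewrite -(count_iota_card m (fun x => x < k)) -[RHS](count_ord_lt km).
by rewrite -[RHS](count_map val (fun x => x < k)) val_enum_ord.
Qed.

Section Adversary.

Variable n : nat.
Local Notation elt := 'I_n.+1.

Definition input (p : {perm elt}) (x : elt) : nat := p x.

Lemma input_inj p : injective (input p).
Proof. by move=> x y /val_inj/perm_inj. Qed.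

Lemma is_median_input p i : is_median (input p) i = (p i == n./2 :> nat).
Proof.
rewrite /is_median /input; congr (_ == _).
have -> : [set j | p j < p i] = p @^-1: [set k : elt | k < p i] by apply/setP => j; rewrite !inE.
rewrite card_preimset; last exact: perm_inj.
exact/card_ord_lt/ltnW.
Qed.

Let lo := n./2.

(* The elements with value in [lo, hi) are the candidates for the median; the adversary
   has fixed the values of all the others. *)
Definition candidate (p : {perm elt}) hi x := lo <= p x < hi.

Definition extends (p0 : {perm elt}) hi (p : {perm elt}) :=
  forall x, ~~ candidate p0 hi x -> p x = p0 x.

(** A non-candidate value is already taken by a non-candidate element, so [p] permutes the candidate
    values among the candidates. *)
Lemma candidate_extends p0 hi p x : extends p0 hi p -> candidate p hi x = candidate p0 hi x.
Proof.
move=> ext; case: (boolP (candidate p0 hi x)) => [cx|ncx]; last first.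
  by rewrite /candidate (ext x ncx); apply: negbTE.
apply: contraT => npx; pose y := (p0^-1)%g (p x).
have p0y : p0 y = p x by rewrite permKV.
have /ext : ~~ candidate p0 hi y by rewrite /candidate p0y.
by rewrite p0y => /perm_inj yx; move: npx; rewrite /candidate -p0y yx -/(candidate _ _ _) cx.
Qed.

(** With a second candidate left, exchanging the values [lo] and [lo.+1] would change the median
    without changing the answer. *)
Lemma leaf_candidate p0 hi i : lo < hi -> hi <= n.+1 ->
  (forall p, extends p0 hi p -> is_median (input p) i) -> p0 i = lo :> nat /\ hi = lo.+1.
Proof.
move=> lohi hin H.
have p0i : p0 i = lo :> nat by apply/eqP; rewrite -is_median_input; apply: H.
split=> //; apply/eqP; rewrite eqn_leq lohi andbT leqNgt; apply/negP => lo1.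
have lo1n : lo.+1 < n.+1 by apply: leq_trans hin.
pose v : elt := Ordinal lo1n.
have := H (p0 * tperm (p0 i) v)%g; rewrite is_median_input permM tpermL /= -/lo.
rewrite -[lo.+1 == lo]/(lo.+1 == lo) gtn_eqF // => Hf; apply: notF; apply: Hf => x ncx.
rewrite permM tpermD //; apply: contraNneq ncx => E; rewrite /candidate -E ?p0i ?leqnn //=.
by rewrite leqnSn.
Qed.

(** Arbitrary weights let the induction continue with the winner's increased weight; at a leaf the
    only candidate carries all of it. *)
Lemma adversary (t : dtree n.+1) p0 hi (w : elt -> nat) : lo < hi -> hi <= n.+1 ->
  (forall p, extends p0 hi p -> is_median (input p) (run t (input p))) ->
  exists p e, [/\ extends p0 hi p, candidate p0 hi e &
    \sum_(x | candidate p0 hi x) w x <= w e * 2 ^ participations t (input p) e].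
Proof.
elim: t p0 hi w => [i|i j l IHl r IHr] p0 hi w lohi hin H.
  have [p0i hiE] := leaf_candidate lohi hin H.
  have cE x : candidate p0 hi x = (x == i).
    rewrite /candidate hiE ltnS -eqn_leq -p0i.
    by apply/eqP/eqP => [/val_inj/perm_inj|->].
  exists p0, i; split; rewrite ?cE ?eqxx //.
  by rewrite (eq_bigl (pred1 i)) // big_pred1_eq muln1.
pose cand := candidate p0 hi.
case: (boolP [&& cand i, cand j & i != j]) => [/and3P[ci cj ij]|nc]; last first.
  (* Non-candidates have fixed values outside the candidate range, so this comparison has the same
     outcome for all extensions. *)
  have cmp p : extends p0 hi p -> (input p i < input p j) = (input p0 i < input p0 j).
    move=> ext; rewrite /input; case: (eqVneq i j) nc => [-> _|ij]; first by rewrite !ltnn.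
    rewrite andbT negb_and => nc.
    have cE := candidate_extends _ ext.
    case/orP: nc => nc; rewrite (ext _ nc).
      case: (boolP (cand j)) => cj; last by rewrite (ext _ cj).
      move: nc (cj) (cE j); rewrite /cand /candidate.
      by move: (nat_of_ord (p0 i)) (nat_of_ord (p0 j)) (nat_of_ord (p j)) => *; lia.
    case: (boolP (cand i)) => ci; last by rewrite (ext _ ci).
    move: nc (ci) (cE i); rewrite /cand /candidate.
    by move: (nat_of_ord (p0 i)) (nat_of_ord (p0 j)) (nat_of_ord (p i)) => *; lia.
  case b : (input p0 i < input p0 j).
    have [|p [e [ext ce le]]] := IHl p0 hi w lohi hin.
      by move=> p ext; have := H p ext; rewrite /= cmp // b.
    exists p, e; split=> //; apply: leq_trans le _; rewrite /= cmp // b.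
    by rewrite leq_mul2l leq_exp2l // leq_addl orbT.
  have [|p [e [ext ce le]]] := IHr p0 hi w lohi hin.
    by move=> p ext; have := H p ext; rewrite /= cmp // b.
  exists p, e; split=> //; apply: leq_trans le _; rewrite /= cmp // b.
  by rewrite leq_mul2l leq_exp2l // leq_addl orbT.
(* The heavier of the two candidates wins and absorbs the weight of the loser, which
   becomes the largest candidate: a win at most doubles the weight. *)
have step u v : cand u -> cand v -> u != v -> w v <= w u ->
    exists p1 w1, [/\ lo < hi.-1,
      forall p, extends p1 hi.-1 p -> extends p0 hi p /\ input p u < input p v,
      forall x, candidate p1 hi.-1 x = cand x && (x != v),
      \sum_(x | candidate p1 hi.-1 x) w1 x = \sum_(x | cand x) w x &
      forall x, x != v -> w1 x <= w x * 2 ^ (x == u)].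
  move=> cu cv uv wvu.
  have hi0 : 0 < hi by apply: leq_trans lohi.
  have hi1 : hi.-1 < n.+1 by rewrite prednK.
  pose top : elt := Ordinal hi1.
  (* The loser takes the top candidate value [hi.-1], and its previous holder receives the loser's
     value. *)
  pose p1 := (p0 * tperm (p0 v) top)%g.
  have c1 x : candidate p1 hi.-1 x = cand x && (x != v).
    move: cv; rewrite /cand /candidate /p1 permM.
    case: tpermP => [/perm_inj ->|E|/eqP n1 /eqP n2].
    - by rewrite eqxx andbF /= ltnn andbF.
    - have : (p0 x : nat) = hi.-1 by rewrite E.
      have -> : (x != v) = ((p0 v : nat) != hi.-1).
        by rewrite eq_sym -(inj_eq (@perm_inj _ p0)) E -val_eqE.
      by move: (nat_of_ord (p0 x)) (nat_of_ord (p0 v)) => *; lia.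
    have -> : x != v by rewrite -(inj_eq (@perm_inj _ p0)).
    have : (p0 x : nat) != hi.-1 by rewrite -val_eqE in n2.
    by move: (nat_of_ord (p0 x)) (nat_of_ord (p0 v)) => *; lia.
  have cu1 : candidate p1 hi.-1 u by rewrite c1 cu.
  have lohi1 : lo < hi.-1 by case/andP: cu1; apply: leq_ltn_trans.
  exists p1, (fun x => if x == u then w u + w v else w x); split=> //.
  - move=> p ext.
    have cpu := candidate_extends u ext.
    have : p v = p1 v by apply: ext; rewrite c1 eqxx andbF.
    rewrite permM tpermL => pv; split.
      move=> x ncx; rewrite (ext x); last by rewrite c1; apply: contra ncx => /andP[].
      rewrite /p1 permM tpermD //.
        by apply: contraNneq ncx => /perm_inj <-.
      apply: contraNneq ncx => E; rewrite /cand /candidate -E /=; lia.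
    by rewrite /input pv /=; move: cpu; rewrite cu1 => /andP[].
  - rewrite (bigD1 u cu1) /= eqxx [RHS](bigD1 v cv) /=.
    rewrite [X in _ = _ + X](bigD1 u) /=; last by rewrite cu.
    rewrite addnA [w v + _]addnC; congr (_ + _).
    rewrite (eq_bigl (fun x => cand x && (x != v) && (x != u))) => [|x]; last by rewrite c1.
    by apply: eq_bigr => x /andP[_ /negPf ->].
  by move=> x xv; case: eqP => [->|_]; rewrite ?muln1 // expn1 muln2 -addnn leq_add2l.
have concl (T : dtree n.+1) u v : (forall p0 hi (w : elt -> nat), lo < hi -> hi <= n.+1 ->
    (forall p, extends p0 hi p -> is_median (input p) (run T (input p))) ->
    exists p e, [/\ extends p0 hi p, candidate p0 hi e &
      \sum_(x | candidate p0 hi x) w x <= w e * 2 ^ participations T (input p) e]) ->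
    cand u -> cand v -> u != v -> w v <= w u ->
    (forall a e, a u < a v -> run (Node i j l r) a = run T a /\
      participations (Node i j l r) a e = ((u == e) || (v == e)) + participations T a e) ->
    exists p e, [/\ extends p0 hi p, candidate p0 hi e &
    \sum_(x | candidate p0 hi x) w x <= w e * 2 ^ participations (Node i j l r) (input p) e].
  move=> IH cu cv uv wvu HT.
  have [p1 [w1 [lohi1 ext1 c1 sumE w1E]]] := step u v cu cv uv wvu.
  have [||p [e [ext ce le]]] := IH p1 hi.-1 w1 lohi1.
  - by apply: leq_trans hin; apply: leq_pred.
  - by move=> p /ext1[ext /(HT _ ord0)[<- _]]; apply: H.
  have [ext' uvp] := ext1 p ext.
  move: ce; rewrite c1 => /andP[ce ev]; exists p, e; split=> //.
  rewrite -/cand -sumE; apply: leq_trans le _; have [_ ->] := HT _ e uvp.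
  apply: leq_trans (leq_mul (w1E e ev) (leqnn _)) _.
  rewrite -mulnA -expnD leq_mul2l leq_exp2l // leq_add2r [u == e]eq_sym.
  by case: (e == u); rewrite ?orbT.
have [wji|wij] := leqP (w j) (w i).
  by apply: (concl l i j IHl) => // b e bij; rewrite /= bij.
apply: (concl r j i IHr) => //; [by rewrite eq_sym|exact: ltnW|] => b e bji.
by rewrite /= orbC ltnNge ltnW.
Qed.

Lemma median_alg_participations (T : dtree n.+1) : median_alg T ->
  exists p e, n.+1 - n./2 <= 2 ^ participations T (input p) e.
Proof.
move=> HT.
have lon : lo < n.+1 by rewrite ltnS /lo -divn2 leq_div.
have [p ext|p [e [_ _ le]]] := adversary (t := T) (p0 := 1%g) (fun=> 1) lon (leqnn _).
  exact: HT (@input_inj p).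
exists p, e; move: le; rewrite mul1n; apply: leq_trans; rewrite sum1_card.
have := cardC (candidate 1 n.+1); rewrite card_ord.
have -> : #|[predC candidate 1 n.+1]| = lo.
  rewrite -[RHS](card_ord_lt (ltnW lon)); apply: eq_card => x.
  by rewrite !inE /= unfold_in /candidate perm1 ltn_ord andbT -ltnNge.
move=> E; apply: (@leq_trans #|candidate 1%g n.+1|); first by rewrite leq_subLR addnC E.
by apply/eq_leq; apply: eq_card.
Qed.

End Adversary.

Lemma inv_leq n (a : 'I_n -> nat) : inv a <= n ^ 2.
Proof. by apply: leq_trans (max_card _) _; rewrite card_prod card_ord. Qed.

Lemma median_lower_bound k : exists n, forall T : dtree n.+1, median_alg T ->
  exists a : 'I_n.+1 -> nat, injective a /\ inv a <= k /\
    exists e : 'I_n.+1, lg k <= 8 * participations T a e.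
Proof.
have [small|large] := leqP (lg k) 8.
  (* Two elements need one comparison, and the constant 8 covers [lg k <= 8]. *)
  exists 1 => T HT; exists (fun x => x); split; first exact: val_inj.
  split.
    rewrite /inv (_ : [set _ | _] = set0) ?cards0 //.
    by apply/setP => p; rewrite !inE; case: ltngtP.
  case: T HT => [i|i j l r] HT.
    have [] := @leaf_candidate 1 1%g 2 i isT isT _; last by [].
    by move=> p _; apply: HT (@input_inj 1 p).
  by exists i; rewrite /= eqxx mulnDr; apply: leq_trans small (leq_addr _ _).
pose h := (lg k)./2; exists (2 ^ h).-1 => T HT.
have P0 : 0 < 2 ^ h by rewrite expn_gt0.
have [p [e le]] := median_alg_participations HT.
exists (input p); split; first exact: input_inj.
split.
  apply: leq_trans (inv_leq _) _; rewrite prednK // -expnM muln2.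
  have k2 : 2 < k.
    by rewrite ltnNge; apply/negP => k2; move: large; rewrite /lg (maxn_idPr k2).
  apply: (@leq_trans (2 ^ lg k)).
    by rewrite leq_exp2l // -[leqRHS](odd_double_half (lg k)) leq_addl.
  by rewrite /lg (maxn_idPl (ltnW k2)) trunc_logP // ltnW // ltnW.
exists e; set q := participations _ _ _.
(* The adversary forces [h.-1] participations, and [lg k <= 2 * h + 1 <= 8 * h.-1] as soon as [h] is
   at least 2. *)
have h4 : 4 <= h by rewrite /h -[4]/(9./2) half_leq.
have : 2 ^ h.-1 <= 2 ^ q.
  apply: leq_trans le; rewrite prednK //.
  have -> : 2 ^ h = 2 * 2 ^ h.-1 by rewrite -expnS prednK // (leq_trans _ h4).
  have : 0 < 2 ^ h.-1 by rewrite expn_gt0.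
  by move: (2 ^ h.-1) => x; lia.
rewrite leq_exp2l // => hq.
have := odd_double_half (lg k); rewrite -/h -muln2; case: odd; lia.
Qed.

Theorem theorem9 :
  (* upper bound: a deterministic algorithm (one decision tree per input size)
     in which every element participates in O(log Inv) comparisons *)
  (exists (c : nat) (A : forall n : nat, dtree n.+1),
      forall n : nat, median_alg (A n) /\
        forall a : 'I_n.+1 -> nat, injective a ->
          forall e : 'I_n.+1, participations (A n) a e <= c * lg (inv a))
  /\
  (* lower bound: for every k there are inputs with Inv <= k on which any
     deterministic median algorithm makes some element participate in
     Omega(log k) comparisons *)
  (exists c : nat, 0 < c /\
     forall k : nat, exists n : nat,
       forall T : dtree n.+1, median_alg T ->
         exists a : 'I_n.+1 -> nat, injective a /\ inv a <= k /\
           exists e : 'I_n.+1, lg k <= c * participations T a e).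
Proof.
split; last by exists 8; split=> // k; apply: median_lower_bound.
(* Expansion 256 leaves the factor 128 after the two halves of a shell are added up. *)
have [d [f fP]] := @expander_family 256 128 isT isT.
exists ((180 * d + 4) * 4), (fun n => to_dtree (phase d f n n 0)) => n; split=> a inj_a.
  by rewrite run_to_dtree; apply: phase_median; rewrite // addn0.
move=> e; rewrite participations_to_dtree -mulnA.
apply: leq_trans (cost_phase fP inj_a e (fuel := n) (i := 0) _ _); first exact: leq_addr.
  by rewrite addn0.
by rewrite expn0 muln_gt0 /= /lg trunc_log_max // leq_maxr.
Qed.
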